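(* Let $a<b$ be real numbers and $I=[a,b]$. Let $f : I \to I$ be a continuous piecewise monotone mapping which is essentially transitive. Then $\mathrm{h}(f) > 0$ and $f$ is conjugate to a uniformly piecewise linear mapping $g : I \to I$ with slope $\exp(\mathrm{h}(f))$.
   Context: $I=[a,b]$ with $a<b$ real; $\mathrm{C}(I)$ is the set of continuous mappings $I\to I$; $f^n$ denotes the $n$-th iterate of $f$ ($f^0=\mathrm{id}_I$). Piecewise monotone: $f\in \mathrm{C}(I)$ is piecewise monotone if there exist $p\ge 0$ and $a=d_0<d_1<\cdots<d_p<d_{p+1}=b$ such that $f$ is strictly monotone on each $[d_k,d_{k+1}]$, $0\le k\le p$. If the $d_k$'s are chosen minimally (i.e. $f$ is not monotone on any open interval containing $d_k$, for each $1\le k\le p$), then $d_1,\dots,d_p$ are called the turning points of $f$ and the intervals $[d_k,d_{k+1}]$, $0\le k\le p$, the laps of $f$. $\mathrm{M}(I)$ denotes the set of piecewise monotone mappings in $\mathrm{C}(I)$; it is closed under composition. $\ell(f)$ is the number of laps of $f\in \mathrm{M}(I)$, and $\mathrm{h}(f)=\inf_{n\ge 1} n^{-1}\log \ell(f^n)$ (this equals the topological entropy of $f$). Uniformly piecewise linear: $g\in \mathrm{M}(I)$ is uniformly piecewise linear with slope $\beta>0$ if on each of its laps $g$ is linear (affine) with slope $\beta$ or $-\beta$. Conjugate: $g,h\in \mathrm{C}(I)$ are conjugate if there is a homeomorphism $\psi:I\to I$ with $\psi\circ g=h\circ\psi$. Cycles: $B\subset I$ is $f$-invariant if $f(B)\subset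 B$. A closed set $C\subset I$ is an $f$-cycle with period $m\ge 1$ if $C$ is the disjoint union of non-trivial closed intervals $B_0,\dots,B_{m-1}$ with $f(B_{k-1})\subset B_k$ for $1\le k\le m-1$ and $f(B_{m-1})\subset B_0$. An $f$-cycle $C$ is transitive if every closed $f$-invariant subset $F$ of $C$ satisfies $F=C$ or $\mathrm{int}(F)=\varnothing$. For $B\subset I$, $\mathrm{E}(B,f)=\{x\in I: f^n(x)\in B \text{ for some } n\ge 0\}$. A mapping $f\in \mathrm{C}(I)$ is essentially transitive if there exists a transitive $f$-cycle $C$ such that $I\setminus \mathrm{E}(C,f)$ is countable (possibly finite or empty). *)

(* Defs.v *)
From mathcomp Require Import all_boot all_order all_algebra.
From mathcomp Require Import all_classical all_reals all_analysis.

Set Implicit Arguments.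
Unset Strict Implicit.
Unset Printing Implicit Defensive.

Import Order.TTheory GRing.Theory Num.Theory.
Import numFieldNormedType.Exports.

Local Open Scope classical_set_scope.
Local Open Scope ring_scope.

(* A mapping of I = [a, b] into itself is represented by a total function
   R -> R; every notion below only depends on its values on [a, b]. *)

Definition interval_map (R : realType) (a b : R) (f : R -> R) : Prop :=
  {within `[a, b], continuous f} /\ f @` `[a, b] `<=` `[a, b].

Definition strictly_monotone_on (R : realType) (J : interval R) (f : R -> R)
    : Prop :=
  {in J &, {homo f : x y / x < y}} \/ {in J &, {homo f : x y /~ x < y}}.

Definition monotone_on (R : realType) (J : interval R) (f : R -> R) : Prop :=
  {in J &, {homo f : x y / x <= y}} \/ {in J &, {homo f : x y /~ x <= y}}.

(* Only the values d 0, ..., d p.+1 are relevant. *)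
Definition monotone_partition (R : realType) (a b : R) (f : R -> R)
    (p : nat) (d : nat -> R) : Prop :=
  [/\ d 0%N = a, d p.+1 = b &
      forall k, (k <= p)%N ->
        d k < d k.+1 /\ strictly_monotone_on `[d k, d k.+1] f].

Definition piecewise_monotone (R : realType) (a b : R) (f : R -> R) : Prop :=
  interval_map a b f /\ exists p d, monotone_partition a b f p d.

(* d 1, ..., d p are the turning points of f, and the [d k, d k.+1] with
   k <= p are its laps. *)
Definition lap_partition (R : realType) (a b : R) (f : R -> R)
    (p : nat) (d : nat -> R) : Prop :=
  monotone_partition a b f p d /\
  forall k, (1 <= k <= p)%N ->
    forall u v, a <= u -> u < d k -> d k < v -> v <= b ->
      ~ monotone_on `]u, v[ f.

(* A piecewise monotone map has exactly one lap partition, up to the irrelevant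
   values d k with p.+1 < k; 0 is a default value for the other maps. *)
Definition lap_number (R : realType) (a b : R) (f : R -> R) : nat :=
  xget 0%N [set n | exists p d, lap_partition a b f p d /\ n = p.+1].

Definition entropy (R : realType) (a b : R) (f : R -> R) : R :=
  inf [set n%:R^-1 * ln (lap_number a b (iter n f))%:R
      | n in [set n : nat | (1 <= n)%N]].

Definition uniformly_piecewise_linear (R : realType) (a b beta : R)
    (g : R -> R) : Prop :=
  [/\ piecewise_monotone a b g, 0 < beta &
      exists p d, lap_partition a b g p d /\
        forall k, (k <= p)%N ->
          exists s c, (s = beta \/ s = - beta) /\
            {in `[d k, d k.+1], forall x, g x = s * x + c}].

Definition interval_homeo (R : realType) (a b : R) (psi : R -> R) : Prop :=
  interval_map a b psi /\
  exists phi, [/\ interval_map a b phi,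
    {in `[a, b], cancel psi phi} & {in `[a, b], cancel phi psi}].

Definition conjugate (R : realType) (a b : R) (g h : R -> R) : Prop :=
  exists psi, interval_homeo a b psi /\
    {in `[a, b], forall x, psi (g x) = h (psi x)}.

Definition invariant_set (R : realType) (f : R -> R) (B : set R) : Prop :=
  f @` B `<=` B.

Definition is_cycle (R : realType) (a b : R) (f : R -> R)
    (m : nat) (C : set R) : Prop :=
  [/\ (1 <= m)%N, closed C, C `<=` `[a, b] &
      exists B : nat -> set R,
      [/\ forall k, (k < m)%N ->
            exists l r : R, l < r /\ B k = `[l, r]%classic,
          trivIset `I_m B,
          C = \bigcup_(k < m) B k,
          forall k, (1 <= k <= m.-1)%N -> f @` B k.-1 `<=` B k &
          f @` B m.-1 `<=` B 0%N]].

(* Closure and interior are taken in R. For subsets of [a, b] with a < b,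
   being closed, resp. having empty interior, means the same in [a, b]. *)
Definition transitive_cycle (R : realType) (a b : R) (f : R -> R)
    (C : set R) : Prop :=
  (exists m, is_cycle a b f m C) /\
  forall F : set R, closed F -> F `<=` C -> invariant_set f F ->
    F = C \/ interior F = set0.

Definition eventually_in (R : realType) (a b : R) (B : set R) (f : R -> R)
    : set R :=
  [set x | x \in `[a, b] /\ exists n, B (iter n f x)].

Definition essentially_transitive (R : realType) (a b : R) (f : R -> R)
    : Prop :=
  interval_map a b f /\
  exists C, transitive_cycle a b f C /\
    countable (`[a, b] `\` eventually_in a b C f).

(* Main.v *)
Require Import Defs.
From mathcomp Require Import all_boot all_order all_algebra.
From mathcomp Require Import all_classical all_reals all_analysis.
From mathcomp Require Import ring lra zify.

(* Let L_n(J) be the least number of strictly monotone pieces of f^n covering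
   an interval J, so that L_n(I) is the lap number of f^n.

   Positive entropy: the first return map G of a transitive cycle to one of its
   intervals has a fixed point z, which by transitivity has a preimage w <> z
   under some G^k.  The iterates of any interval containing z reach w, so two
   disjoint pieces of [z, w], one at z and one at w, both cover [z, w] under a
   common iterate of G.  This horseshoe makes the lap numbers grow
   exponentially, i.e. beta = exp(h(f)) > 1.

   Semiconjugacy: psi(x) is an ultrafilter limit of the ratios of
   sum_{k<n} L_k([a, x]) beta^-k to sum_{k<n} L_k(I) beta^-k.  If f is monotone
   on J then L_{k+1}(J) = L_k(f(J)), so the measure with distribution function
   psi is multiplied by beta on every lap; it has no atoms because
   psi(J) <= L_m(J) beta^-m.

   Injectivity: if psi were constant on an interval K in the transitive cycle C,
   then, as K meets some f^q(K), psi would take finitely many values on the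
   orbit of K, hence on C; so psi would take countably many values on each
   f^-n(C), hence on I, although psi(I) = [0, 1].  If psi is constant on an
   arbitrary interval J, then each f^n(J) therefore meets each interval of C in
   at most one point, so J is countable. *)

Set Implicit Arguments.
Unset Strict Implicit.
Unset Printing Implicit Defensive.

Import Order.TTheory GRing.Theory Num.Theory.
Import numFieldNormedType.Exports.

Local Open Scope classical_set_scope.
Local Open Scope ring_scope.

(** * Coverings by strictly monotone pieces *)

Definition incr {R : realType} (g : R -> R) (x y : R) : Prop :=
  forall u v, x <= u -> u < v -> v <= y -> g u < g v.

Definition decr {R : realType} (g : R -> R) (x y : R) : Prop :=
  forall u v, x <= u -> u < v -> v <= y -> g v < g u.

Definition smono {R : realType} (g : R -> R) (x y : R) : Prop :=
  incr g x y \/ decr g x y.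

(* Cut points may coincide, so [pieces g n x y] means that at most [n]
   strictly monotone pieces of [g] cover [[x, y]]. *)
Fixpoint pieces {R : realType} (g : R -> R) (n : nat) (x y : R) : Prop :=
  if n is n'.+1 then
    exists m, [/\ x <= m, m <= y, smono g x m & pieces g n' m y]
  else x = y.

Section Pieces.
Context {R : realType}.
Implicit Types (f g : R -> R) (x y z u v : R) (n m : nat).

Lemma strictly_monotone_onP g x y :
  strictly_monotone_on `[x, y] g <-> smono g x y.
Proof.
split=> [[] h|[] h].
- by left=> u v xu uv vy; apply: h => //; rewrite in_itv /=; apply/andP; split; lra.
- by right=> u v xu uv vy; apply: h => //; rewrite in_itv /=; apply/andP; split; lra.
- by left=> u v; rewrite !in_itv /= => /andP[? ?] /andP[? ?] uv; apply: h.
- by right=> u v; rewrite !in_itv /= => /andP[? ?] /andP[? ?] uv; apply: h.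
Qed.

Lemma smono_sub g x y u v : smono g x y -> x <= u -> v <= y -> smono g u v.
Proof.
move=> [] h xu vy; [left|right] => s t us st tv; apply: h => //; lra.
Qed.

Lemma smono_refl g x : smono g x x.
Proof. by left => u v ? ? ?; lra. Qed.

Lemma smono_ext g f x y : (forall u, x <= u <= y -> g u = f u) ->
  smono g x y -> smono f x y.
Proof.
move=> e [] h; [left|right] => u v xu uv vy; rewrite -!e; try (by apply: h);
  apply/andP; split; lra.
Qed.

Lemma smono_inj g x y u v : smono g x y -> x <= u <= y -> x <= v <= y ->
  g u = g v -> u = v.
Proof.
move=> sg /andP[xu uy] /andP[xv vy] e.
have [uv|vu|//] := ltgtP u v; case: sg => h.
- by have := h u v xu uv vy; lra.
- by have := h u v xu uv vy; lra.
- by have := h v u xv vu uy; lra.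
- by have := h v u xv vu uy; lra.
Qed.

Lemma incr_le g x y u v : incr g x y -> x <= u -> u <= v -> v <= y -> g u <= g v.
Proof.
move=> ig xu; rewrite le_eqVlt => /orP[/eqP->//|uv] vy.
exact/ltW/ig.
Qed.

Lemma decr_le g x y u v : decr g x y -> x <= u -> u <= v -> v <= y -> g v <= g u.
Proof.
move=> ig xu; rewrite le_eqVlt => /orP[/eqP->//|uv] vy.
exact/ltW/ig.
Qed.

Lemma pieces_order g n x y : pieces g n x y -> x <= y.
Proof.
elim: n x => [x ->//|n IH x [m [xm my _ /IH]]]; lra.
Qed.

Lemma pieces_leq g n m x y : (n <= m)%N -> pieces g n x y -> pieces g m x y.
Proof.
move=> nm p; rewrite -(subnK nm); elim: (m - n)%N => //= k IH.
exists x; split => //; [exact: pieces_order p|exact: smono_refl].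
Qed.

Lemma pieces1 g x y : x <= y -> smono g x y -> pieces g 1 x y.
Proof. by move=> xy s; exists y; split. Qed.

Lemma pieces_ext g f n x y : (forall u, x <= u <= y -> g u = f u) ->
  pieces g n x y -> pieces f n x y.
Proof.
elim: n x => //= n IH x e [m [xm my s p]]; exists m; split => //.
  by apply: smono_ext s => u /andP[? ?]; apply: e; apply/andP; split; lra.
by apply: IH p => u /andP[? ?]; apply: e; apply/andP; split; lra.
Qed.

Lemma pieces_cat g n m x y z :
  pieces g n x y -> pieces g m y z -> pieces g (n + m) x z.
Proof.
elim: n x => [x ->//|n IH x [w [xw wy s p]] q].
exists w; split => //; last exact: IH q.
by have := pieces_order q; lra.
Qed.

Lemma pieces_rcons g n x y z :
  pieces g n x y -> y <= z -> smono g y z -> pieces g n.+1 x z.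
Proof.
by move=> p yz s; rewrite -addn1; apply: pieces_cat p _; exact: pieces1.
Qed.

(** Cutting at [y] splits at most one piece, which accounts for the surplus of one in the sum of the
    two counts. *)
Lemma pieces_split g n x y z : pieces g n x z -> x <= y -> y <= z ->
  exists n1 n2, [/\ pieces g n1 x y, pieces g n2 y z &
    [/\ (n1 <= n)%N, (n2 <= n)%N & (n1 + n2 <= n.+1)%N]].
Proof.
elim: n x => [x e xy yz|n IH x [m [xm mz s p]] xy yz].
  by have {}e : x = z := e; exists 0%N, 0%N; split => //=; lra.
have [ym|my] := leP y m.
  exists 1%N, n.+1; split; [|  |by split].
    by apply: pieces1 => //; apply: (smono_sub s).
  by exists m; split => //; apply: (smono_sub s) => //; lra.
have [n1 [n2 [p1 p2 [h1 h2 h3]]]] := IH m p (ltW my) yz.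
exists n1.+1, n2; split => //; first by exists m; split => //; lra.
split; lia.
Qed.

Lemma pieces_sub g n x y u v : pieces g n x y -> x <= u -> u <= v -> v <= y ->
  pieces g n u v.
Proof.
move=> p xu uv vy.
have uy : u <= y by lra.
have [n1 [n2 [p1 p2 [h1 h2 _]]]] := pieces_split p xu uy.
have [n3 [n4 [p3 p4 [h3 h4 _]]]] := pieces_split p2 uv vy.
by apply: pieces_leq p3; lia.
Qed.

End Pieces.

(** * Monotone pieces under composition *)

Section PiecesComposition.
Context {R : realType} (f : R -> R) (f_cont : continuous f).
Implicit Types (g : R -> R) (x y z u v : R) (n m : nat).

Lemma cont_surj x y c : x <= y ->
  f x <= c <= f y \/ f y <= c <= f x ->
  exists2 w, x <= w <= y & f w = c.
Proof.
move=> xy h.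
have [|w] := @IVT R f x y c xy (continuous_subspaceT f_cont).
  by rewrite minEle maxEle; case: (leP (f x) (f y)) => ?; case: h => /andP[? ?]; apply/andP; split; lra.
by rewrite in_itv /= => wxy <-; exists w.
Qed.

Lemma smono_pull_incr g x y : incr f x y -> smono g (f x) (f y) ->
  smono (g \o f) x y.
Proof.
move=> fi [] h; [left|right] => u v xu uv vy /=; apply: h.
- by apply: (incr_le fi) => //; lra.
- exact: fi.
- by apply: (incr_le fi) => //; lra.
- by apply: (incr_le fi) => //; lra.
- exact: fi.
- by apply: (incr_le fi) => //; lra.
Qed.

Lemma smono_pull_decr g x y : decr f x y -> smono g (f y) (f x) ->
  smono (g \o f) x y.
Proof.
move=> fi [] h; [right|left] => u v xu uv vy /=; apply: h.
- by apply: (decr_le fi) => //; lra.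
- exact: fi.
- by apply: (decr_le fi) => //; lra.
- by apply: (decr_le fi) => //; lra.
- exact: fi.
- by apply: (decr_le fi) => //; lra.
Qed.

Lemma incr_reflect x y u v : incr f x y -> x <= u <= y -> x <= v <= y ->
  f u < f v -> u < v.
Proof.
move=> fi /andP[? ?] /andP[? ?] h; case: (ltP u v) => // vu.
have : f v <= f u by apply: (incr_le fi); lra.
lra.
Qed.

Lemma decr_reflect x y u v : decr f x y -> x <= u <= y -> x <= v <= y ->
  f u < f v -> v < u.
Proof.
move=> fi /andP[? ?] /andP[? ?] h; case: (ltP v u) => // vu.
have : f v <= f u by apply: (decr_le fi); lra.
lra.
Qed.

(** Points of [[f x, f y]] are lifted to [[x, y]] by the intermediate value theorem, and [f]
    reflects their order. *)
Lemma smono_push_incr g x y : x <= y -> incr f x y -> smono (g \o f) x y ->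
  smono g (f x) (f y).
Proof.
move=> xy fi s.
have S c : f x <= c -> c <= f y -> exists2 w, x <= w <= y & f w = c.
  by move=> ? ?; apply: cont_surj => //; left; apply/andP; split.
case: s => h; [left|right] => u v xu uv vy.
- have [|u' u'i eu] := S u xu; first lra.
  have [|v' v'i ev] := S v _ vy; first lra.
  rewrite -eu -ev; case/andP: (u'i) (v'i) => ? ? /andP[? ?].
  by apply: (h u' v') => //; apply: (incr_reflect fi u'i v'i); lra.
- have [|u' u'i eu] := S u xu; first lra.
  have [|v' v'i ev] := S v _ vy; first lra.
  rewrite -eu -ev; case/andP: (u'i) (v'i) => ? ? /andP[? ?].
  by apply: (h u' v') => //; apply: (incr_reflect fi u'i v'i); lra.
Qed.

Lemma smono_push_decr g x y : x <= y -> decr f x y -> smono (g \o f) x y ->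
  smono g (f y) (f x).
Proof.
move=> xy fi s.
have S c : f y <= c -> c <= f x -> exists2 w, x <= w <= y & f w = c.
  by move=> ? ?; apply: cont_surj => //; right; apply/andP; split.
case: s => h; [right|left] => u v xu uv vy.
- have [|u' u'i eu] := S u xu; first lra.
  have [|v' v'i ev] := S v _ vy; first lra.
  rewrite -eu -ev; case/andP: (u'i) (v'i) => ? ? /andP[? ?].
  by apply: (h v' u') => //; apply: (decr_reflect fi u'i v'i); lra.
- have [|u' u'i eu] := S u xu; first lra.
  have [|v' v'i ev] := S v _ vy; first lra.
  rewrite -eu -ev; case/andP: (u'i) (v'i) => ? ? /andP[? ?].
  by apply: (h v' u') => //; apply: (decr_reflect fi u'i v'i); lra.
Qed.

Lemma pieces_pull_incr g n x y : x <= y -> incr f x y ->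
  pieces g n (f x) (f y) -> pieces (g \o f) n x y.
Proof.
elim: n x => [x xy fi e|n IH x xy fi [c [xc cy s p]]].
  by apply: (smono_inj (or_introl fi)) => //; apply/andP; split; lra.
have [|w /andP[xw wy] ew] := @cont_surj x y c xy; first by left; apply/andP; split.
have fi1 : incr f x w by move=> u v ? ? ?; apply: fi => //; lra.
have fi2 : incr f w y by move=> u v ? ? ?; apply: fi => //; lra.
exists w; split => //; first by apply: smono_pull_incr => //; rewrite ew.
by apply: IH => //; rewrite ew.
Qed.

Lemma pieces_pull_decr g n x y : x <= y -> decr f x y ->
  pieces g n (f y) (f x) -> pieces (g \o f) n x y.
Proof.
elim: n y => [y xy fi e|n IH y xy fi [c [xc cy s p]]].
  by apply: (smono_inj (or_intror fi)) => //; apply/andP; split; lra.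
have [|w /andP[xw wy] ew] := @cont_surj x y c xy; first by right; apply/andP; split.
have fi1 : decr f x w by move=> u v ? ? ?; apply: fi => //; lra.
have fi2 : decr f w y by move=> u v ? ? ?; apply: fi => //; lra.
apply: (@pieces_rcons _ _ _ _ w) => //; last by apply: smono_pull_decr => //; rewrite ew.
by apply: IH => //; rewrite ew.
Qed.

Lemma pieces_push_incr g n x y : incr f x y ->
  pieces (g \o f) n x y -> pieces g n (f x) (f y).
Proof.
elim: n x => [x fi /= ->//|n IH x fi [w [xw wy s p]]].
have fi1 : incr f x w by move=> u v ? ? ?; apply: fi => //; lra.
have fi2 : incr f w y by move=> u v ? ? ?; apply: fi => //; lra.
exists (f w); split; last exact: IH.
- exact: (incr_le fi1).
- exact: (incr_le fi2).
- exact: smono_push_incr.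
Qed.

Lemma pieces_push_decr g n x y : decr f x y ->
  pieces (g \o f) n x y -> pieces g n (f y) (f x).
Proof.
elim: n x => [x fi /= ->//|n IH x fi [w [xw wy s p]]].
have fi1 : decr f x w by move=> u v ? ? ?; apply: fi => //; lra.
have fi2 : decr f w y by move=> u v ? ? ?; apply: fi => //; lra.
apply: (@pieces_rcons _ _ _ _ (f w)); first exact: IH.
- exact: (decr_le fi1).
- exact: smono_push_decr.
Qed.

(** Each piece of [f] is mapped onto an interval that [m] pieces of [g] cover, and these pull back
    through [f]. This is the source of the submultiplicativity of lap numbers. *)
Lemma pieces_comp g n m x y :
  (forall u v, x <= u <= y -> x <= v <= y -> f u <= f v ->
    pieces g m (f u) (f v)) ->
  pieces f n x y -> pieces (g \o f) (n * m) x y.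
Proof.
elim: n x => [x _ ->//|n IH x hg [w [xw wy s p]]].
rewrite mulSn; apply: (@pieces_cat _ _ _ _ _ w); last first.
  by apply: IH p => u v /andP[? ?] /andP[? ?] ?; apply: hg => //; apply/andP; split; lra.
case: s => s.
- apply: pieces_pull_incr => //; apply: hg; [apply/andP; split; lra..|].
  exact: (incr_le s).
- apply: pieces_pull_decr => //; apply: hg; [apply/andP; split; lra..|].
  exact: (decr_le s).
Qed.

End PiecesComposition.

(** A one-point interval has count 0, the empty covering being enough; the same value is the default
    when no finite covering exists. *)
Definition lapc {R : realType} (g : R -> R) (x y : R) : nat :=
  xget 0%N [set n | pieces g n x y /\ forall k, pieces g k x y -> (n <= k)%N].

(** * Minimal coverings and lap partitions *)

Section LapCount.
Context {R : realType}.
Implicit Types (f g : R -> R) (x y z u v : R) (n m p k : nat) (d : nat -> R).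

Lemma lapc_spec g x y n : pieces g n x y ->
  pieces g (lapc g x y) x y /\ forall k, pieces g k x y -> (lapc g x y <= k)%N.
Proof.
move=> pn; have ex : exists n, `[< pieces g n x y >] by exists n; exact/asboolP.
have : [set n | pieces g n x y /\ forall k, pieces g k x y -> (n <= k)%N]
    (lapc g x y).
  apply: (@xgetPex _ 0%N); case: (ex_minnP ex) => m /asboolP pm mmin.
  by exists m; split => // k /asboolP; exact: mmin.
by [].
Qed.

Lemma lapc_pieces g x y n : pieces g n x y -> pieces g (lapc g x y) x y.
Proof. by move=> /lapc_spec[]. Qed.

Lemma lapc_le g x y n : pieces g n x y -> (lapc g x y <= n)%N.
Proof. by move=> h; have [_ ] := lapc_spec h; apply. Qed.

Lemma lapc_gt0 g x y n : x < y -> pieces g n x y -> (0 < lapc g x y)%N.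
Proof.
move=> xy /lapc_pieces; case: (lapc g x y) => //= e; lra.
Qed.

Lemma pieces_chain g d i n : (forall k, (i <= k < i + n)%N ->
    d k < d k.+1 /\ strictly_monotone_on `[d k, d k.+1] g) ->
  pieces g n (d i) (d (i + n)%N).
Proof.
elim: n i => [i _ /=|n IH i h]; first by rewrite addn0.
have [|lt /strictly_monotone_onP s] := h i; first lia.
have p : pieces g n (d i.+1) (d (i + n.+1)%N).
  by rewrite -addSnnS; apply: IH => k ?; apply: h; lia.
by exists (d i.+1); split => //; [exact: ltW|exact: pieces_order p].
Qed.

Lemma monotone_partition_pieces x y g p d :
  monotone_partition x y g p d -> pieces g p.+1 x y.
Proof.
move=> [d0 dp h]; rewrite -d0 -dp -[X in d X]add0n.
by apply: pieces_chain => k ?; apply: h; lia.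
Qed.

(** Degenerate pieces are dropped. A partition with [p] interior points has [p.+1] intervals, whence
    the strict inequality [p < n]. *)
Lemma pieces_monotone_partition g n x y : x < y -> pieces g n x y ->
  exists p d, (p < n)%N /\ monotone_partition x y g p d.
Proof.
elim: n x => [x xy /= e|n IH x xy [m [xm my s pm]]]; first lra.
move: xm; rewrite le_eqVlt => /orP[/eqP e|xm].
  have [p [d [pn h]]] : exists p d, (p < n)%N /\ monotone_partition x y g p d.
    by apply: IH => //; rewrite e.
  by exists p, d; split => //; lia.
move: my; rewrite le_eqVlt => /orP[/eqP e|my].
  exists 0%N, (fun k => if k is 0%N then x else y); split => //; split => // k.
  by rewrite leqn0 => /eqP ->; split => //; apply/strictly_monotone_onP; rewrite -e.
have [p [d [pn [d0 dp h]]]] := IH m my pm.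
exists p.+1, (fun k => if k is k'.+1 then d k' else x); split => //; split => //.
case=> [_|k kp]; last exact: h.
by rewrite d0; split => //; exact/strictly_monotone_onP.
Qed.

(** A map that is monotone around [y] cannot increase strictly on one side of [y] and decrease
    strictly on the other. *)
Lemma smono_merge g x y z u v : x < y -> y < z -> u < y -> y < v ->
  monotone_on `]u, v[ g -> smono g x y -> smono g y z -> smono g x z.
Proof.
move=> xy yz uy yv mo sl sr.
(* The points [s < y < t] lie in the two pieces and also in []u, v[]; their values refute
   monotonicity when the two directions differ. *)
pose s := (Num.max x u + y) / 2; pose t := (y + Num.min z v) / 2.
have [xs us sy] : [/\ x <= s, u < s & s < y].
  by rewrite /s; case: (leP x u) => ?; split; lra.
have [yt tv tz] : [/\ y < t, t < v & t <= z].
  by rewrite /t; case: (leP z v) => ?; split; lra.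
have sI : s \in `]u, v[ by rewrite in_itv /=; apply/andP; split; lra.
have yI : y \in `]u, v[ by rewrite in_itv /=; apply/andP; split.
have tI : t \in `]u, v[ by rewrite in_itv /=; apply/andP; split; lra.
case: sl sr => l [] r.
- left => w w' xw ww wz.
  have [w'y|yw'] := leP w' y; first exact: l.
  have [yw|wy] := leP y w; first exact: r.
  by have := l w y xw wy (lexx _); have := r y w' (lexx _) yw' wz; lra.
- have gs := l s y xs sy (lexx _); have gt := r y t (lexx _) yt tz.
  case: mo => h; first by have := h y t yI tI (ltW yt); lra.
  by have := h y s yI sI (ltW sy); lra.
- have gs := l s y xs sy (lexx _); have gt := r y t (lexx _) yt tz.
  case: mo => h; first by have := h s y sI yI (ltW sy); lra.
  by have := h t y tI yI (ltW yt); lra.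
- right => w w' xw ww wz.
  have [w'y|yw'] := leP w' y; first exact: l.
  have [yw|wy] := leP y w; first exact: r.
  by have := l w y xw wy (lexx _); have := r y w' (lexx _) yw' wz; lra.
Qed.

Lemma smono_monotone_on g x y : smono g x y -> monotone_on `]x, y[ g.
Proof.
by case=> h; [left|right] => u v; rewrite !in_itv /= => /andP[? ?] /andP[? ?];
  rewrite le_eqVlt => /orP[/eqP ->//|?]; apply/ltW/h => //; apply/ltW.
Qed.

Lemma monotone_partition_ge x y g p d k : monotone_partition x y g p d ->
  (k <= p.+1)%N -> x <= d k /\ d k <= y.
Proof.
move=> [d0 dp h] kp; rewrite -d0 -dp; split.
  rewrite -[X in _ <= d X]add0n; apply: pieces_order (pieces_chain (g := g) _) => i ?.
  by apply: h; lia.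
rewrite -(subnKC kp); apply: pieces_order (pieces_chain (g := g) _) => i ?.
by apply: h; lia.
Qed.

(** A strictly monotone piece has no turning point in its interior, so each piece of a covering
    advances by at most one lap. *)
Lemma lap_partition_min x y g p d n : lap_partition x y g p d ->
  pieces g n x y -> (p < n)%N.
Proof.
move=> [mp tp] pn; have [d0 dp h] := mp.
(* Here the current cut point [w] lies in lap [k] and [m] pieces remain to be used. *)
suff H m k w : (k <= p)%N -> d k <= w -> w < d k.+1 -> pieces g m w y ->
    (p < m + k)%N.
  rewrite -(addn0 n); apply: (H n 0%N x) => //; first by rewrite d0.
  by have [] := h 0%N isT; rewrite d0.
elim: m k w => [k w kp dw wd /= e|m IH k w kp dw wd [c [wc cy s pc]]].
  by have [_] := monotone_partition_ge mp (kp : (k.+1 <= p.+1)%N); lra.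
have [kltp|pk] := ltnP k p; last by lia.
have cd : c <= d k.+1.
  rewrite leNgt; apply/negP => dc.
  have xd := monotone_partition_ge mp (leqW kp).
  apply: (tp k.+1 _ w c) => //; try lra.
  exact: smono_monotone_on.
move: cd; rewrite le_eqVlt => /orP[/eqP e|cd].
  rewrite addSnnS; apply: (IH k.+1 c) => //; first by rewrite e.
  by have [] := h k.+1 kltp; rewrite e.
by have := IH k c kp _ cd pc; move=> /(_ _); rewrite addSn => hh; apply: leqW; apply: hh; lra.
Qed.

(** A partition of minimal length is a lap partition: if the map were monotone around some [d k],
    the two adjacent intervals would merge by [smono_merge], against minimality. *)
Lemma lap_partition_exists g n x y : x < y -> pieces g n x y ->
  exists p d, lap_partition x y g p d /\ lapc g x y = p.+1.
Proof.
move=> xy /lapc_spec[pn lmin].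
have [p [d [pl mp]]] := pieces_monotone_partition xy pn.
have lp : lapc g x y = p.+1.
  by apply/eqP; rewrite eqn_leq pl andbT; apply/lmin/(monotone_partition_pieces mp).
exists p, d; split => //; split => // -[//|k] kp u v xu ud dv vy mo.
have [d0 dp h] := mp.
have {}kp : (k < p)%N by lia.
have [lt1 /strictly_monotone_onP s1] := h k (ltnW kp).
have [lt2 /strictly_monotone_onP s2] := h k.+1 kp.
have s := smono_merge lt1 lt2 ud dv mo s1 s2.
have p1 : pieces g k x (d k).
  rewrite -d0 -[X in d X]add0n; apply: pieces_chain => i ?; apply: h; lia.
have p2 : pieces g (p - k.+1) (d k.+2) y.
  rewrite -dp -(_ : (k.+2 + (p - k.+1) = p.+1)%N); last lia.
  apply: pieces_chain => i ?; apply: h; lia.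
have dd : d k <= d k.+2 by lra.
have := lmin _ (pieces_cat (pieces_rcons p1 dd s) p2).
by rewrite lp; lia.
Qed.

(** Two lap partitions have the same length, since [lap_partition_min] applies to each as a covering
    for the other; this determines the [xget] in [lap_number]. *)
Lemma lap_number_lapc g n x y : x < y -> pieces g n x y ->
  lap_number x y g = lapc g x y.
Proof.
move=> xy pn; have [p [d [lp ->]]] := lap_partition_exists xy pn.
rewrite /lap_number; apply: xget_unique; first by exists p, d.
move=> _ [p' [d' [lp' ->]]]; congr S; apply/eqP; rewrite eqn_leq.
have := lap_partition_min lp (monotone_partition_pieces lp'.1).
have := lap_partition_min lp' (monotone_partition_pieces lp.1).
by rewrite !ltnS => -> ->.
Qed.

Lemma lapc_ext g f x y : (forall u, x <= u <= y -> g u = f u) ->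
  lapc g x y = lapc f x y.
Proof.
move=> e; rewrite /lapc; congr (xget 0%N _); apply/seteqP.
have E n : pieces g n x y <-> pieces f n x y.
  by split; apply: pieces_ext => u /e.
by split=> n /= [/E p h]; split => // k /E; exact: h.
Qed.

End LapCount.

(** * Growth of lap numbers *)

Lemma continuous_iter {T : topologicalType} (f : T -> T) n :
  continuous f -> continuous (iter n f).
Proof.
move=> cf; elim: n => [|n IH] x; first exact: cvg_id.
exact: (continuous_comp (IH x) (cf _)).
Qed.

Section IterateCount.
Context {R : realType} (a b : R) (F : R -> R).
Hypotheses (hab : a < b) (F_cont : continuous F)
  (F_in : forall x, a <= F x <= b) (F_pm : exists n, pieces F n a b).
Implicit Types (x y z u v : R) (n m k : nat).

Local Notation L k x y := (lapc (iter k F) x y).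

Lemma iter_in k x : a <= x <= b -> a <= iter k F x <= b.
Proof. by case: k => [|k] //= _. Qed.

Lemma pieces_iterD n m n1 m1 x y : a <= x -> y <= b ->
  pieces (iter m F) m1 x y -> pieces (iter n F) n1 a b ->
  pieces (iter (n + m) F) (m1 * n1) x y.
Proof.
move=> ax yb pm pn.
apply: (@pieces_ext _ (iter n F \o iter m F)); first by move=> u _; rewrite iterD.
apply: pieces_comp pm; first exact: continuous_iter.
move=> u v /andP[xu uy] /andP[xv vy] uv; apply: pieces_sub pn _ uv _.
  have /andP[//] : a <= iter m F u <= b by apply: iter_in; apply/andP; split; lra.
have /andP[//] : a <= iter m F v <= b by apply: iter_in; apply/andP; split; lra.
Qed.

Lemma pieces_iter k : exists n, pieces (iter k F) n a b.
Proof.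
elim: k => [|k [n IH]].
  by exists 1%N; apply: pieces1; [exact: ltW|left=> u v].
have [m pm] := F_pm; exists (n * m)%N.
by rewrite -add1n; apply: pieces_iterD.
Qed.

Lemma L_pieces k x y : a <= x -> x <= y -> y <= b ->
  pieces (iter k F) (L k x y) x y.
Proof.
move=> ax xy yb; have [n pn] := pieces_iter k.
exact: lapc_pieces (pieces_sub pn ax xy yb).
Qed.

Lemma L_gt0 k x y : a <= x -> x < y -> y <= b -> (0 < L k x y)%N.
Proof. by move=> ax xy yb; apply: lapc_gt0 xy (L_pieces k ax (ltW xy) yb). Qed.

Lemma L_submult n m x y : a <= x -> x <= y -> y <= b ->
  (L (n + m) x y <= L m x y * L n a b)%N.
Proof.
move=> ax xy yb; apply/lapc_le/pieces_iterD => //; first exact: L_pieces.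
by apply: L_pieces => //; exact: ltW.
Qed.

Lemma L_sub k x y u v : a <= x -> x <= u -> u <= v -> v <= y -> y <= b ->
  (L k u v <= L k x y)%N.
Proof.
move=> ax xu uv vy yb; apply: lapc_le.
have xy : x <= y by lra.
exact: pieces_sub (L_pieces k ax xy yb) xu uv vy.
Qed.

(** The count is additive up to an error of one, uniformly in [k]. Weighted by the powers of
    [beta^-1], these errors have a bounded sum, so they vanish in the normalized limit. *)
Lemma L_cat k x y z : a <= x -> x <= y -> y <= z -> z <= b ->
  (L k x z <= L k x y + L k y z)%N /\ (L k x y + L k y z <= (L k x z).+1)%N.
Proof.
move=> ax xy yz zb; split.
  by apply: lapc_le; apply: (@pieces_cat _ _ _ _ _ y); apply: L_pieces => //; lra.
have p : pieces (iter k F) (L k x z) x z by apply: L_pieces => //; lra.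
have [n1 [n2 [/lapc_le h1 /lapc_le h2 [_ _ h]]]] := pieces_split p xy yz.
lia.
Qed.

Lemma L_xx k x : L k x x = 0%N.
Proof. by apply/eqP; rewrite -leqn0; exact: lapc_le. Qed.

Lemma L0_le1 x y : x <= y -> (L 0 x y <= 1)%N.
Proof. by move=> xy; apply/lapc_le/pieces1 => //; left. Qed.

(** [F] is a homeomorphism from [[x, y]] onto [[F x, F y]], which matches pieces of [iter k.+1 F]
    with pieces of [iter k F]. In the limit this identity becomes multiplication by [beta]. *)
Lemma L_incr k x y : a <= x -> x <= y -> y <= b -> incr F x y ->
  L k.+1 x y = L k (F x) (F y).
Proof.
move=> ax xy yb fi.
have E : L k.+1 x y = lapc (iter k F \o F) x y.
  by apply: lapc_ext => u _; rewrite iterSr.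
rewrite E; apply/eqP; rewrite eqn_leq; apply/andP; split.
  apply/lapc_le/pieces_pull_incr => //; apply: L_pieces.
  - by case/andP: (F_in x).
  - exact: (incr_le fi).
  - by case/andP: (F_in y).
apply/lapc_le/pieces_push_incr => //; rewrite -E.
by apply: pieces_ext (L_pieces k.+1 ax xy yb) => u _; rewrite iterSr.
Qed.

Lemma L_decr k x y : a <= x -> x <= y -> y <= b -> decr F x y ->
  L k.+1 x y = L k (F y) (F x).
Proof.
move=> ax xy yb fi.
have E : L k.+1 x y = lapc (iter k F \o F) x y.
  by apply: lapc_ext => u _; rewrite iterSr.
rewrite E; apply/eqP; rewrite eqn_leq; apply/andP; split.
  apply/lapc_le/pieces_pull_decr => //; apply: L_pieces.
  - by case/andP: (F_in y).
  - exact: (decr_le fi).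
  - by case/andP: (F_in x).
apply/lapc_le/pieces_push_decr => //; rewrite -E.
by apply: pieces_ext (L_pieces k.+1 ax xy yb) => u _; rewrite iterSr.
Qed.

End IterateCount.

(* Otherwise the partial sums, hence [c], would eventually grow at least like
   [(1 + e) ^+ n], against submultiplicativity and the rate hypothesis. *)
Lemma subexponential_ratio {R : realType} (c : nat -> R) :
  (forall n, 1 <= c n) -> (forall n m, c (n + m)%N <= c n * c m) ->
  (forall e, 0 < e -> exists2 m, (0 < m)%N & c m < (1 + e) ^+ m) ->
  forall e, 0 < e -> forall n0, exists2 n, (n0 <= n)%N &
    c n <= e * \sum_(k < n) c k.
Proof.
move=> c1 csub crate e e0 n0; apply: contrapT => H.
pose A n := \sum_(k < n) c k.
have {}H n : (n0.+1 <= n)%N -> e * A n < c n.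
  move=> n0n; rewrite ltNge; apply/negP => h; apply: H.
  by exists n => //; exact: ltnW.
have AS n : A n.+1 = A n + c n by rewrite /A big_ord_recr.
have A0 n : 0 <= A n.
  by apply: sumr_ge0 => i _; apply: le_trans (c1 i).
(* From the index [n0.+1] on, the negated claim says that each partial sum exceeds [1 + e] times the
   previous one. *)
have A1 j : (1 + e) ^+ j <= A (n0.+1 + j)%N.
  elim: j => [|j IH].
    by rewrite expr0 addn0 AS; have := A0 n0; have := c1 n0; lra.
  rewrite addnS AS exprS.
  have := H (n0.+1 + j)%N (leq_addr _ _).
  have : e * (1 + e) ^+ j <= e * A (n0.+1 + j)%N by rewrite ler_pM2l.
  lra.
have [m m0 cm] := crate e e0.
have cq q : c (q.+1 * m)%N <= c m ^+ q.+1.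
  elim: q => [|q IH]; first by rewrite mul1n expr1.
  rewrite mulSn exprS; apply: le_trans (csub _ _) _.
  by rewrite ler_wpM2l //; apply: le_trans (c1 m).
have e1 : 0 < (1 + e) ^+ m by apply: exprn_gt0; lra.
have en0 : 0 < (1 + e) ^+ n0.+1 by apply: exprn_gt0; lra.
(* The rate hypothesis gives [r < 1], whereas the growth of the partial sums bounds the powers of
   [r] below by a positive constant. *)
pose r := c m / (1 + e) ^+ m.
have r0 : 0 <= r by apply: divr_ge0; [apply: le_trans (c1 m)|exact: ltW].
have r1 : `|r| < 1 by rewrite ger0_norm // ltr_pdivrMr // mul1r.
have low q : (n0.+1 <= q.+1 * m)%N -> e / (1 + e) ^+ n0.+1 <= r ^+ q.+1.
  move=> qn; rewrite /r expr_div_n -exprM.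
  have en : 0 < (1 + e) ^+ (m * q.+1) by apply: exprn_gt0; lra.
  rewrite ler_pdivrMr // mulrAC ler_pdivlMr //.
  rewrite mulnC -{1}(subnKC qn) exprD mulrCA mulrC ler_pM2r //.
  apply: le_trans (cq q); apply/ltW; apply: le_lt_trans (H _ qn).
  by rewrite ler_pM2l // -{2}(subnKC qn).
have := cvg_expr r1.
move=> /cvgrPdist_lt /(_ (e / (1 + e) ^+ n0.+1)) [].
  exact: divr_gt0.
move=> N _ /(_ (N + n0).+1) /=.
have -> : (N <= (N + n0).+1)%N by lia.
move=> /(_ isT); rewrite sub0r normrN ger0_norm ?exprn_ge0 //.
rewrite ltNge low //.
by nia.
Qed.

(** * The semiconjugacy *)

(** With compactness of [[0, 1]], this lets one ultrafilter on [nat] provide the limits of the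
    ratios at all points [x] simultaneously. *)
Lemma ultra_fmap {T U : Type} (f : T -> U) (G : set_system T) :
  UltraFilter G -> UltraFilter (f @ G).
Proof.
move=> GU; split=> [|H HP GH]; first exact: fmap_proper_filter.
apply/seteqP; split=> // A HA.
have [//|nA] := in_ultra_setVsetC (f @^-1` A) GU.
have HnA : H (~` A) by apply: GH.
by have [x []] := filter_ex (filterI HA HnA).
Qed.

Section SemiConjugacy.
Context {R : realType} (a b : R) (F : R -> R).
Hypotheses (hab : a < b) (F_cont : continuous F)
  (F_in : forall x, a <= F x <= b) (F_pm : exists n, pieces F n a b).
Variable beta : R.
Hypotheses (beta1 : 1 < beta)
  (L_low : forall n, beta ^+ n <= (lapc (iter n F) a b)%:R)
  (L_rate : forall e, 0 < e -> exists2 m, (0 < m)%N &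
    (lapc (iter m F) a b)%:R < (beta * (1 + e)) ^+ m).

Implicit Types (x y z u v : R) (n m k : nat).

Local Notation L k x y := (lapc (iter k F) x y).

Let D n x y : R := \sum_(k < n) (L k x y)%:R / beta ^+ k.
(** The sum of the geometric series of ratio [beta^-1], which bounds the total additivity error of
    [D]. *)
Let S : R := beta / (beta - 1).

Let beta_gt0 : 0 < beta.
Proof. exact: lt_trans ltr01 beta1. Qed.

Let betaX_gt0 k : 0 < beta ^+ k. Proof. exact: exprn_gt0. Qed.

Let geo_le n : \sum_(k < n) (1 / beta ^+ k) <= S.
Proof.
have b1 := beta1.
elim: n => [|n IH]; first by rewrite big_ord0 divr_ge0 //; lra.
rewrite big_ord_recl expr0.
under eq_bigr => i _ do rewrite lift0 exprS invfM mulrCA.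
rewrite -mulr_sumr.
have -> : S = 1 / 1 + beta^-1 * S.
  by rewrite /S mulrA mulVf ?gt_eqF // ; field; lra.
by rewrite lerD2l ler_pM2l // invr_gt0.
Qed.

Let c n : R := (L n a b)%:R / beta ^+ n.

Let c_ge1 n : 1 <= c n.
Proof. by rewrite /c ler_pdivlMr // mul1r. Qed.

Let D_ge n : n%:R <= D n a b.
Proof.
elim: n => [|n IH]; first by rewrite /D big_ord0.
by rewrite /D big_ord_recr /= -addn1 natrD; apply: lerD => //; exact: c_ge1.
Qed.

Let D_catl n x y z : a <= x -> x <= y -> y <= z -> z <= b ->
  D n x z <= D n x y + D n y z.
Proof.
move=> ax xy yz zb; rewrite /D -big_split /=; apply: ler_sum => k _.
have [h _] := L_cat hab F_cont F_in F_pm k ax xy yz zb.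
by rewrite -mulrDl ler_pM2r ?invr_gt0 // -natrD ler_nat.
Qed.

Let D_catr n x y z : a <= x -> x <= y -> y <= z -> z <= b ->
  D n x y + D n y z <= D n x z + S.
Proof.
move=> ax xy yz zb; apply: (@le_trans _ _ (D n x z + \sum_(k < n) (1 / beta ^+ k))).
  rewrite /D -!big_split /=; apply: ler_sum => k _.
  have [_ h] := L_cat hab F_cont F_in F_pm k ax xy yz zb.
  by rewrite -!mulrDl ler_pM2r ?invr_gt0 // -natrD natr1 ler_nat.
by rewrite lerD2l.
Qed.

Let D_sub n x y u v : a <= x -> x <= u -> u <= v -> v <= y -> y <= b ->
  D n u v <= D n x y.
Proof.
move=> ax xu uv vy yb; apply: ler_sum => k _.
by rewrite ler_pM2r ?invr_gt0 // ler_nat; apply: (L_sub hab).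
Qed.

Let D_ge0 n x y : 0 <= D n x y.
Proof. by apply: sumr_ge0 => k _; rewrite divr_ge0 // ltW. Qed.

Let D_xx n x : D n x x = 0.
Proof. by rewrite /D big1 // => k _; rewrite L_xx mul0r. Qed.

(** Shifting the summation index leaves two boundary terms: the one for [k = 0], at most 1, and the
    one for [k = n], at most [c n]. *)
Let D_step n x y u v : a <= x -> x <= y -> y <= b ->
  (forall k, L k.+1 x y = L k u v) ->
  `|D n x y - beta^-1 * D n u v| <= 1 + c n.
Proof.
move=> ax xy yb h.
have E1 : D n.+1 x y = (L 0 x y)%:R + beta^-1 * D n u v.
  rewrite /D big_ord_recl expr0 divr1; congr (_ + _).
  rewrite mulr_sumr; apply: eq_bigr => i _.
  by rewrite lift0 h exprS invfM mulrCA.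
have E2 : D n.+1 x y = D n x y + (L n x y)%:R / beta ^+ n.
  by rewrite /D big_ord_recr.
have l0 : ((L 0 x y)%:R : R) <= 1 by rewrite lern1; exact: L0_le1.
have l0' : 0 <= ((L 0 x y)%:R : R) by [].
have ln : (L n x y)%:R / beta ^+ n <= c n.
  by rewrite /c ler_pM2r ?invr_gt0 // ler_nat; apply: (L_sub hab).
have ln' : 0 <= (L n x y)%:R / beta ^+ n by rewrite divr_ge0 // ltW.
by rewrite ler_norml; apply/andP; split; lra.
Qed.

(** The first [m] terms are bounded by [D m a b], the later ones by submultiplicativity. Dividing by
    [D n a b] and letting it grow bounds the increments of [psi]. *)
Let D_contract m n x y : a <= x -> x <= y -> y <= b ->
  D n x y <= D m a b + (L m x y)%:R / beta ^+ m * D n a b.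
Proof.
move=> ax xy yb.
have : D (m + n) x y <= D m a b + (L m x y)%:R / beta ^+ m * D n a b.
  rewrite {1}/D big_split_ord /=; apply: lerD; first exact: D_sub.
  rewrite mulr_sumr; apply: ler_sum => k _.
  rewrite exprD invfM mulrACA ler_pM2r ?mulr_gt0 ?invr_gt0 //.
  by rewrite -natrM ler_nat addnC; apply: (L_submult hab).
apply: le_trans; rewrite addnC /D big_split_ord /= lerDl.
by apply: sumr_ge0 => k _; rewrite divr_ge0 // ltW.
Qed.

(** The ratios [c] are at least 1, submultiplicative and subexponential, so [subexponential_ratio]
    applies. Along the chosen indices the boundary term [c n] of [D_step] is negligible against
    [D n a b]. *)
Let good_index j : exists n, (j < n)%N /\ c n <= j.+1%:R^-1 * D n a b.
Proof.
have csub n m : c (n + m)%N <= c n * c m.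
  rewrite /c exprD invfM mulrACA ler_pM2r ?mulr_gt0 ?invr_gt0 //.
  by rewrite -natrM ler_nat mulnC; apply: (L_submult hab) => //; exact: ltW.
have crate e : 0 < e -> exists2 m, (0 < m)%N & c m < (1 + e) ^+ m.
  move=> e0; have [m m0 h] := L_rate e0; exists m => //.
  by rewrite /c ltr_pdivrMr // -exprMn mulrC.
have j0 : 0 < j.+1%:R^-1 :> R by rewrite invr_gt0.
by have [n n1 n2] := subexponential_ratio c_ge1 csub crate j0 j.+1; exists n.
Qed.

Lemma semiconjugacy : exists psi : R -> R,
  [/\ psi a = 0, psi b = 1,
    forall x y, a <= x -> x <= y -> y <= b -> psi x <= psi y,
    forall x y m, a <= x -> x <= y -> y <= b ->
      psi y - psi x <= (L m x y)%:R / beta ^+ m &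
    (forall x y, a <= x -> x <= y -> y <= b -> incr F x y ->
      psi (F y) - psi (F x) = beta * (psi y - psi x)) /\
    (forall x y, a <= x -> x <= y -> y <= b -> decr F x y ->
      psi (F x) - psi (F y) = beta * (psi y - psi x))].
Proof.
have b0 := beta_gt0; have b1 := beta1.
have [s sP] := choice good_index.
(* The normalization [A j] tends to infinity, so errors bounded independently of [j] disappear after
   division by it. *)
pose A j := D (s j) a b.
have A_ge j : j.+1%:R <= A j.
  by apply: le_trans (D_ge _); rewrite ler_nat; case: (sP j).
have A_gt0 j : 0 < A j by apply: lt_le_trans (A_ge j).
pose p j x := D (s j) a x / A j.
(* An ultrafilter containing the cofinal sets: bounded sequences converge along it, and quantities
   of order [1 / j] tend to 0. *)
have [U [Uultra Uoo]] := @ultraFilterLemma nat \oo _.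
have UP : ProperFilter U by exact: ultra_proper.
have UF : Filter U by exact: filter_filter.
have lim_ex x : exists l : R, a <= x <= b -> p j x @[j --> U] --> l.
  have [/andP[ax xb]|] := boolP (a <= x <= b); last by exists 0.
  have p01 j : p j x \in `[0, 1].
    rewrite in_itv /=; apply/andP; split; first by apply: divr_ge0 => //; exact: ltW.
    by rewrite /p ler_pdivrMr // mul1r; exact: D_sub.
  have /= := @segment_compact R 0 1; rewrite compact_ultra.
  move=> /(_ (p j x @[j --> U])) [].
  - exact: ultra_fmap.
  - by apply: nearW => j; exact: p01.
  - by move=> l [_ pl]; exists l => _.
have [psi psiP] := choice lim_ex.
(* The inequalities satisfied by [psi] all follow from this criterion; equalities use it twice, with
   opposite signs. *)
have lim_le (u : nat -> R) (l K : R) : u j @[j --> U] --> l ->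
    (forall j, u j <= K / j.+1%:R) -> l <= 0.
  move=> ul uK; rewrite leNgt; apply/negP => l0.
  have l2 : 0 < l / 2 by lra.
  have near1 : \forall j \near U, `|l - u j| < l / 2 by move/cvgrPdist_lt : ul; apply.
  have near2 : \forall j \near U, K / j.+1%:R < l / 2.
    apply: Uoo; exists (Num.truncn (2 * K / l)).+1 => // j /= jK.
    rewrite ltr_pdivrMr //; have := truncnS_gt (2 * K / l).
    rewrite ltr_pdivrMr // => h; have : (Num.truncn (2 * K / l)).+1%:R <= j.+1%:R :> R.
      by rewrite ler_nat; exact: leqW.
    by move=> /(ler_wpM2r (ltW l0)); lra.
  have [j []] := filter_ex (filterI near1 near2).
  by rewrite ltr_norml => /andP[? ?] /(le_lt_trans (uK j)); lra.
have ab x : a <= x -> x <= b -> a <= x <= b by move=> -> ->.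
have psi_a : psi a = 0.
  have := psiP a (ab _ (lexx _) (ltW hab)).
  have -> : p ^~ a = cst 0 by apply/funext => j; rewrite /p D_xx mul0r.
  by move=> h; exact: (cvg_unique _ h (cvg_cst _)).
have psi_b : psi b = 1.
  have := psiP b (ab _ (ltW hab) (lexx _)).
  have -> : p ^~ b = cst 1 by apply/funext => j; apply/divff/lt0r_neq0/A_gt0.
  by move=> h; exact: (cvg_unique _ h (cvg_cst _)).
have psi_contr x y m : a <= x -> x <= y -> y <= b ->
    psi y - psi x <= (L m x y)%:R / beta ^+ m.
  move=> ax xy yb.
  have cx := psiP x (ab _ ax (le_trans xy yb)).
  have cy := psiP y (ab _ (le_trans ax xy) yb).
  rewrite -subr_le0.
  apply: (@lim_le _ _ (D m a b) (cvgB (cvgB cy cx) (cvg_cst _))) => j /=.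
  have h := D_catl (s j) (lexx a) ax xy yb.
  have h2 := D_contract m (s j) ax xy yb.
  have Aj := lt0r_neq0 (A_gt0 j).
  have -> : p j y - p j x - (L m x y)%:R / beta ^+ m =
      (D (s j) a y - D (s j) a x - (L m x y)%:R / beta ^+ m * A j) / A j.
    by rewrite [RHS]mulrBl mulfK // mulrBl.
  apply: (@le_trans _ _ (D m a b / A j)).
    by rewrite ler_pM2r ?invr_gt0 // /A; lra.
  by rewrite ler_wpM2l // lef_pV2 // posrE.
have psi_step x y u v : a <= x -> x <= y -> y <= b ->
    a <= u -> u <= v -> v <= b -> (forall k, L k.+1 x y = L k u v) ->
    psi v - psi u = beta * (psi y - psi x).
  move=> ax xy yb au uv vb h.
  have cx := psiP x (ab _ ax (le_trans xy yb)).
  have cy := psiP y (ab _ (le_trans ax xy) yb).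
  have cu := psiP u (ab _ au (le_trans uv vb)).
  have cv := psiP v (ab _ (le_trans au uv) vb).
  have lim := cvgB (cvgB cy cx) (cvgM (cvg_cst beta^-1) (cvgB cv cu)).
  have lim' := cvgB (cvgM (cvg_cst beta^-1) (cvgB cv cu)) (cvgB cy cx).
  (* The lack of additivity of [D] costs at most [2 * S], and [D_step] costs [1 + c (s j)]. Both 1
     and [c (s j)] are at most [A j / j.+1%:R], which gives the constant [2 * S + 2]. *)
  have bnd j : `|p j y - p j x - beta^-1 * (p j v - p j u)| <= (2 * S + 2) / j.+1%:R.
    have -> : p j y - p j x - beta^-1 * (p j v - p j u) =
        (D (s j) a y - D (s j) a x - beta^-1 * (D (s j) a v - D (s j) a u)) / A j.
      by rewrite mulrBl -mulrA !mulrBl.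
    have S0 : 0 <= S by rewrite divr_ge0 //; lra.
    have h1 := D_catl (s j) (lexx a) ax xy yb.
    have h2 := D_catr (s j) (lexx a) ax xy yb.
    have h3 := D_catl (s j) (lexx a) au uv vb.
    have h4 := D_catr (s j) (lexx a) au uv vb.
    have h5 := D_step (s j) ax xy yb h.
    have [_ h6] := sP j.
    have i0 : 0 < beta^-1 by rewrite invr_gt0.
    have i1 : beta^-1 < 1 by rewrite invf_lt1.
    rewrite normrM [`|(A j)^-1|]gtr0_norm ?invr_gt0 // ler_pdivrMr //.
    apply: (@le_trans _ _ (2 * S + 1 + c (s j))).
      move: h5; rewrite !ler_norml => /andP[h5 h5']; apply/andP.
      have iS : beta^-1 * S <= S by rewrite -[leRHS]mul1r ler_wpM2r // ltW.
      have h3' := ler_wpM2l (ltW i0) h3; have h4' := ler_wpM2l (ltW i0) h4.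
      rewrite !mulrDr in h3' h4'; split; lra.
    have h7 : 1 <= j.+1%:R^-1 * A j.
      by rewrite mulrC ler_pdivlMr // mul1r.
    have h8 : c (s j) <= j.+1%:R^-1 * A j by [].
    rewrite -mulrA; move: (j.+1%:R^-1 * A j) h7 h8 => t h7 h8.
    have S1 : 0 <= 2 * S + 1 by lra.
    have := ler_wpM2l S1 h7; lra.
  have e1 := @lim_le _ _ (2 * S + 2) (lim UF UF UF UF UF).
  have e2 := @lim_le _ _ (2 * S + 2) (lim' UF UF UF UF UF).
  have {}e1 : psi y - psi x - beta^-1 * (psi v - psi u) <= 0.
    by apply: e1 => j; have := bnd j; rewrite ler_norml => /andP[].
  have {}e2 : beta^-1 * (psi v - psi u) - (psi y - psi x) <= 0.
    by apply: e2 => j; have := bnd j; rewrite -normrN opprB ler_norml => /andP[].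
  have -> : psi y - psi x = beta^-1 * (psi v - psi u) by lra.
  by rewrite mulVKf // gt_eqF.
exists psi; split => //.
- move=> x y ax xy yb.
  have cx := psiP x (ab _ ax (le_trans xy yb)).
  have cy := psiP y (ab _ (le_trans ax xy) yb).
  rewrite -subr_le0; apply: (@lim_le _ _ 0 (cvgB cx cy)) => j /=.
  by rewrite mul0r subr_le0 ler_pM2r ?invr_gt0 //; apply: D_sub.
- split=> x y ax xy yb fi.
  + apply: psi_step => //.
    * by case/andP: (F_in x).
    * exact: (incr_le fi).
    * by case/andP: (F_in y).
    * by move=> k; apply: (L_incr hab).
  + apply: psi_step => //.
    * by case/andP: (F_in y).
    * exact: (decr_le fi).
    * by case/andP: (F_in x).
    * by move=> k; apply: (L_decr hab).
Qed.

End SemiConjugacy.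

(** * Horseshoes of transitive maps *)

Section Covering.
Context {R : realType}.
Implicit Types (g : R -> R) (x y z u v c : R) (n k q : nat) (s : seq R).

Lemma pieces_nonconst_right g n x y : x < y -> pieces g n x y ->
  exists2 w, x < w <= y & smono g x w.
Proof.
elim: n x => [x xy /= e|n IH x xy [m [xm my s p]]]; first lra.
move: xm; rewrite le_eqVlt => /orP[/eqP e|xm]; last by exists m; rewrite ?xm.
by rewrite -e in p; exact: IH.
Qed.

Lemma pieces_nonconst_left g n x y : x < y -> pieces g n x y ->
  exists2 w, x <= w < y & smono g w y.
Proof.
elim: n x => [x xy /= e|n IH x xy [m [xm my s p]]]; first lra.
move: my; rewrite le_eqVlt => /orP[/eqP e|my].
  by exists x; rewrite ?lexx // -e.
have [w /andP[mw wy] sw] := IH m my p.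
by exists w => //; rewrite wy andbT; lra.
Qed.

(** A strictly monotone piece contains at most one point of a fiber. The condition [x < y] excludes
    a single point, which is covered by zero pieces. *)
Lemma size_fiber_le g n x y s c : x < y -> pieces g n x y -> uniq s ->
  {in s, forall t, x <= t <= y /\ g t = c} -> (size s <= n)%N.
Proof.
elim: n x s => [x s xy /= e|n IH x s xy [m [xm my sm p]] us hs]; first lra.
have one (s' : seq R) : uniq s' ->
    {in s', forall t, x <= t <= m /\ g t = c} -> (size s' <= 1)%N.
  case: s' => [//|t1 [//|t2 s']] /= /andP[]; rewrite inE negb_or => /andP[/eqP ne _] _ h.
  case: ne; have [i1 g1] := h t1 (mem_head _ _).
  have [|i2 g2] := h t2; first by rewrite !inE eqxx orbT.
  by apply: (smono_inj sm i1 i2); rewrite g1 g2.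
move: my; rewrite le_eqVlt => /orP[/eqP e|my].
  by apply: (leq_trans (one s us _)) => //; rewrite e.
move: xm; rewrite le_eqVlt => /orP[/eqP e|xm].
  by apply: leqW; apply: (IH m) => //; rewrite -e.
rewrite -(count_predC (fun t => t <= m)) -!size_filter -add1n; apply: leq_add.
  apply: one; first exact: filter_uniq.
  by move=> t; rewrite mem_filter => /andP[tm /hs [/andP[-> _] ->]]; rewrite tm.
apply: (IH m) => //; first exact: filter_uniq.
move=> t; rewrite mem_filter /= -ltNge => /andP[mt /hs [/andP[_ ->] ->]].
by rewrite (ltW mt).
Qed.

Definition covers g u v x y :=
  forall c, x <= c <= y -> exists2 t, u <= t <= v & g t = c.

(** Since [[u, v]] lies in [[x, y]], the covering can be repeated; this brings two coverings with
    different times to a common iterate. *)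
Lemma covers_iter g u v x y n : x <= u -> v <= y -> covers g u v x y ->
  covers (iter n.+1 g) u v x y.
Proof.
move=> xu vy h; elim: n => [//|n IH] c /h [t tuv <-].
have [|t' t'uv et] := IH t; last by exists t' => //; rewrite iterS et.
by case/andP: tuv => ? ?; apply/andP; split; lra.
Qed.

(** Every point of [[x, y]] has a preimage in each of the two disjoint subintervals, so each
    backward step doubles the fiber. *)
Lemma horseshoe_fiber g u1 v1 u2 v2 x y :
  x <= u1 -> v1 <= y -> x <= u2 -> v2 <= y -> v1 < u2 \/ v2 < u1 ->
  covers g u1 v1 x y -> covers g u2 v2 x y ->
  forall q c, x <= c <= y -> exists s, [/\ uniq s, size s = (2 ^ q)%N &
    {in s, forall t, x <= t <= y /\ iter q g t = c}].
Proof.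
move=> xu1 v1y xu2 v2y dis h1 h2; elim=> [|q IH] c cxy.
  by exists [:: c]; split => // t; rewrite inE => /eqP ->.
have [t1 /andP[ut1 tv1] e1] := h1 c cxy.
have [t2 /andP[ut2 tv2] e2] := h2 c cxy.
have [|s1 [us1 ss1 hs1]] := IH t1; first by apply/andP; split; lra.
have [|s2 [us2 ss2 hs2]] := IH t2; first by apply/andP; split; lra.
exists (s1 ++ s2); split.
- rewrite cat_uniq us1 us2 andbT /=; apply/hasPn => t /hs2[_ et2].
  by apply/negP => /hs1[_ et1]; case: dis; lra.
- by rewrite size_cat ss1 ss2 expnS mul2n addnn.
- move=> t; rewrite mem_cat => /orP[/hs1|/hs2] [it et]; split => //.
    by rewrite iterS et.
  by rewrite iterS et.
Qed.

Lemma cont_surj_segment g u v (p q : R) c : continuous g ->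
  u <= p <= v -> u <= q <= v -> g p <= c <= g q ->
  exists2 t, u <= t <= v & g t = c.
Proof.
move=> gc /andP[up pv] /andP[uq qv] h.
have [pq|/ltW qp] := leP p q.
  have [|t /andP[pt tq] e] := @cont_surj _ g gc p q c pq; first by left.
  by exists t => //; apply/andP; split; lra.
have [|t /andP[pt tq] e] := @cont_surj _ g gc q p c qp; first by right.
by exists t => //; apply/andP; split; lra.
Qed.

End Covering.

Lemma closure_invariant {T : topologicalType} (g : T -> T) (X : set T) :
  continuous g -> (forall x, X x -> X (g x)) ->
  forall x, closure X x -> closure X (g x).
Proof.
move=> gc gX x cx N /gc gN; have [y [Xy Ny]] := cx _ gN.
by exists (g y); split => //; exact: gX.
Qed.

Lemma closed_image_segment {R : realType} (g : R -> R) u v :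
  continuous g -> closed (g @` `[u, v]).
Proof.
move=> gc; apply: compact_closed; first exact: Rhausdorff.
apply: continuous_compact; last exact: segment_compact.
exact: continuous_subspaceT.
Qed.

(** * Transitive piecewise monotone maps of an interval *)

Section Horseshoe.
Context {R : realType} (l r : R) (G : R -> R).
Hypotheses (lr : l < r) (G_cont : continuous G)
  (G_in : forall x, l <= x <= r -> l <= G x <= r)
  (G_pm : forall k, exists n, pieces (iter k G) n l r).
Hypothesis G_trans : forall X : set R, closed X -> X `<=` `[l, r] ->
  (forall x, X x -> X (G x)) -> forall u v, u < v -> `[u, v] `<=` X ->
  `[l, r] `<=` X.

Implicit Types (x y z u v w c : R) (n k q i : nat).

Let iter_cont k : continuous (iter k G).
Proof. exact: continuous_iter. Qed.

Let iter_inv k x : l <= x <= r -> l <= iter k G x <= r.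
Proof. by move=> h; elim: k => //= k IH; exact: G_in. Qed.

Let iter_nonconst k u v : l <= u -> u < v -> v <= r ->
  exists2 w, u < w <= v & smono (iter k G) u w.
Proof.
move=> lu uv vr; have [n pn] := G_pm k.
exact: pieces_nonconst_right uv (pieces_sub pn lu (ltW uv) vr).
Qed.

(** The image of [[l, r]] is closed and invariant, and it contains a nondegenerate interval because
    [G] is not constant; transitivity makes it everything. *)
Let G_surj y : l <= y <= r -> exists2 x, l <= x <= r & G x = y.
Proof.
move=> ylr.
suff : `[l, r] `<=` G @` `[l, r].
  by move=> /(_ y); rewrite /= in_itv /= => /(_ ylr) [x]; rewrite in_itv /=; exists x.
have [w /andP[lw wr] s] := iter_nonconst 1 (lexx l) lr (lexx r).
have ne : G l != G w.
  apply/eqP => e; suff : l = w by lra.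
  by apply: (smono_inj s) => //; rewrite lexx ltW.
have sub u v : l <= u <= r -> l <= v <= r -> `[G u, G v] `<=` G @` `[l, r].
  move=> ui vi c /=; rewrite in_itv /= => h.
  have [t ti <-] := cont_surj_segment G_cont ui vi h.
  by exists t => //; rewrite /= in_itv.
have li : l <= l <= r by rewrite lexx ltW.
have wi : l <= w <= r by rewrite (ltW lw) wr.
have T := G_trans (closed_image_segment (u := l) (v := r) G_cont).
case: (ltgtP (G l) (G w)) ne => // lt _.
- apply: (T _ _ _ _ lt); [| |exact: sub].
    by move=> _ [x + <-]; rewrite /= !in_itv /=; exact: G_in.
  move=> _ [x + <-]; rewrite /= in_itv /= => xi; exists (G x) => //=.
  by rewrite in_itv /= G_in.
- apply: (T _ _ _ _ lt); [| |exact: sub].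
    by move=> _ [x + <-]; rewrite /= !in_itv /=; exact: G_in.
  move=> _ [x + <-]; rewrite /= in_itv /= => xi; exists (G x) => //=.
  by rewrite in_itv /= G_in.
Qed.

(** The intermediate value theorem is applied to [G x - x] between [l] and a preimage [y] of [l]. If
    [z = r] then [y = r], and [l = G r = r], which is absurd; so there is room to the right of
    [z]. *)
Let fixpoint : exists2 z, l <= z < r & G z = z.
Proof.
have h := lr.
have [y /andP[ly yr] Gy] := @G_surj l ltac:(by rewrite lexx ltW).
have Gid_cont : continuous (fun x => G x - x).
  by move=> x; apply: cvgB; [exact: G_cont|exact: cvg_id].
have /andP[Gl _] : l <= G l <= r by apply: G_in; rewrite lexx ltW.
have [|z /andP[lz zy] ez] := @cont_surj _ _ Gid_cont l y 0 ly.
  by right; apply/andP; split; lra.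
exists z; last lra.
rewrite lz /= lt_neqAle (le_trans zy yr) andbT; apply/eqP => e.
have yz : y = z by lra.
by move: Gy ez; rewrite yz; lra.
Qed.

Let fix_iter z k : G z = z -> iter k G z = z.
Proof. by move=> e; elim: k => //= k ->. Qed.

(* If [z] had no other preimage under [G \o G], then a small interval, or the
   complement of one, together with its image by [G], would be invariant. *)
Let homoclinic z : l <= z < r -> G z = z ->
  exists w k, [/\ l <= w <= r, w != z & iter k G w = z].
Proof.
move=> /andP[lz zr] Gz; apply: contrapT => H.
have {}H w k : l <= w <= r -> w != z -> iter k G w != z.
  by move=> wi wz; apply/eqP => e; apply: H; exists w, k.
(* If [[u, v]] is invariant under [G \o G], its union with its image under [G] is closed and
   [G]-invariant, hence is all of [[l, r]]. *)
have T u v : l <= u -> u < v -> v <= r ->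
    (forall x, u <= x <= v -> u <= G (G x) <= v) ->
    forall x, l <= x <= r -> u <= x <= v \/ exists2 y, u <= y <= v & G y = x.
  move=> lu uv vr inv x xlr.
  have uvlr y : u <= y <= v -> l <= y <= r.
    by move=> /andP[? ?]; apply/andP; split; lra.
  have : (`[l, r] `<=` `[u, v] `|` G @` `[u, v])%classic.
    apply: (@G_trans _ _ _ _ u v uv).
    - apply: closedU; [exact: itv_closed|exact: closed_image_segment].
    - move=> y [|[t + <-]]; rewrite /= !in_itv /=; first exact: uvlr.
      by move=> /uvlr; exact: G_in.
    - move=> y [|[t + <-]]; rewrite /= in_itv /= => yi.
        by right; exists y => //; rewrite /= in_itv.
      by left; rewrite /= in_itv /=; exact: inv.
    - by move=> y yi; left.
  move=> /(_ x); rewrite /= !in_itv /= => /(_ xlr)[|[t]]; first by left.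
  by rewrite in_itv /=; right; exists t.
(* No iterate sends a point other than [z] to [z], so [iter k G x - z] has constant sign on each
   side of [z]. *)
have sgn k x y : l <= x <= r -> l <= y <= r ->
    (z < x /\ z < y) \/ (x < z /\ y < z) ->
    z < iter k G x -> z < iter k G y.
  move=> xlr ylr sd zGx; rewrite ltNge; apply/negP => Gyz.
  have [m [M [mx my xM yM mM]]] : exists m M,
      [/\ m <= x, m <= y, x <= M, y <= M & l <= m /\ M <= r /\ (z < m \/ M < z)].
    case/andP: xlr ylr => ? ? /andP[? ?].
    by have [xy|yx] := leP x y; [exists x, y|exists y, x]; split; lra.
  have [|||t /andP[mt tM] et] := @cont_surj_segment _ (iter k G) m M y x z (@iter_cont k).
  - by rewrite my yM.
  - by rewrite mx xM.
  - by rewrite Gyz ltW.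
  have tlr : l <= t <= r by apply/andP; split; lra.
  have tz : t != z by apply/eqP; lra.
  by have /eqP := H t k tlr tz.
(* Otherwise [G] exchanges the sides in such a way that [[l, z]] is invariant under [G], and then
   [r] cannot be reached, against [T]. *)
have side w : z < w <= r -> z < G (G w).
  move=> /andP[zw wr].
  have wlr : l <= w <= r by apply/andP; split; lra.
  have wz : w != z by rewrite gt_eqF.
  have Gw := G_in wlr; have GGw := G_in Gw.
  rewrite lt_neqAle eq_sym (H w 2%N) //=.
  rewrite leNgt; apply/negP => GGwz.
  have /= Gwz := H w 1%N wlr wz.
  have [zGw|Gwlt|e] := ltgtP z (G w).
  - by have /= := sgn 1%N w (G w) wlr Gw (or_introl (conj zw zGw)) zGw; lra.
  - have left x : l <= x <= z -> l <= G x <= z.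
      move=> /andP[lx xz].
      have xlr : l <= x <= r by apply/andP; split; lra.
      case/andP: (G_in xlr) => -> Gxr /=.
      move: xz; rewrite le_eqVlt => /orP[/eqP ->|xz]; first by rewrite Gz.
      rewrite leNgt; apply/negP => zGx.
      by have /= := sgn 1%N x (G w) xlr Gw (or_intror (conj xz Gwlt)) zGx; lra.
    have lz' : l < z by case/andP: Gw => ? ?; lra.
    have rI : l <= r <= r by rewrite lexx ltW.
    case: (T l z (lexx _) lz' (ltW zr) _ r rI).
    + by move=> x /left/left.
    + by move=> /andP[]; lra.
    + by move=> [y /left /andP[? ?] e]; lra.
  - by rewrite e eqxx in Gwz.
(* If [G \o G] moves points just right of [z] away from it, some [[e', r]] with [z < e'] is
   invariant under [G \o G]; by [T], [z] would then have another preimage. *)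
have [[e e0 inc]|noinc] := pselect (exists2 e, 0 < e &
    forall x, z < x < z + e -> x < G (G x)).
  have [d [zd de dr]] : exists d, [/\ z < d, d < z + e & d < r].
    exists (z + Num.min e (r - z) / 2).
    by have [?|?] := leP e (r - z); split; lra.
  have [|c cI cmin] := @EVT_min R (iter 2 G) d r (ltW dr).
    exact: continuous_subspaceT.
  move: cI; rewrite in_itv /= => /andP[dc cr].
  have zc : z < G (G c) by apply: side; rewrite cr andbT; lra.
  have [e' [ze' e'd e'c]] : exists e', [/\ z < e', e' <= d & e' <= G (G c)].
    exists (Num.min d (G (G c))); split; rewrite ?lt_min ?zd ?zc //.
      by rewrite ge_min lexx.
    by rewrite ge_min lexx orbT.
  have lt' : e' < r by lra.
  have le' : l <= e' by lra.
  have zI : l <= z <= r by apply/andP; split; lra.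
  case: (T e' r le' lt' (lexx _) _ z zI).
  - move=> x /andP[e'x xr].
    have xlr : l <= x <= r by apply/andP; split; lra.
    have /andP[_ ->] := G_in (G_in xlr); rewrite andbT.
    have [xd|dx] := leP x d.
      have /inc : z < x < z + e by apply/andP; split; lra.
      lra.
    have : G (G c) <= G (G x) by apply: cmin; rewrite in_itv /= xr andbT ltW.
    lra.
  - by move=> /andP[]; lra.
  - move=> [y /andP[e'y yr] /eqP].
    by apply/negP; apply: (H y 1%N); [apply/andP; split|apply/eqP]; lra.
(* In the other case there are points [x] arbitrarily close to [z] on the right with [G (G x) <= x].
   As [G \o G] increases there, [[z, x]] is invariant, but neither it nor its image under [G]
   contains [r]. *)
have [d /andP[zd dr] sd] := @iter_nonconst 2 z r lz zr (lexx r).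
have Hz : iter 2 G z = z by exact: fix_iter.
have {}sd : incr (iter 2 G) z d.
  case: sd => // sd; have := sd z d (lexx _) zd (lexx _).
  have : z < G (G d) by apply: side; rewrite zd.
  by rewrite Hz /=; lra.
have rz : 0 < r - z by lra.
have [eta /= eta0 etaP] : exists2 eta, 0 < eta &
    forall y, `|y - z| < eta -> `|G y - z| < r - z.
  have /cvgrPdist_lt /(_ _ rz) : G y @[y --> z] --> G z by exact: G_cont.
  move=> /nbhs_ballP[eta /= eta0 hb]; exists eta => // y yz.
  by rewrite distrC -[X in `|X - _|]Gz; apply: hb; rewrite /ball /= distrC.
apply: noinc; exists (Num.min eta (d - z)).
  by rewrite lt_min eta0 /=; lra.
move=> x /andP[zx xe]; rewrite ltNge; apply/negP => Gxx.
have {xe} [xeta xd] : x < z + eta /\ x < d.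
  by move: xe; case: (leP eta (d - z)) => ? ?; split; lra.
have rI : l <= r <= r by rewrite lexx ltW.
case: (T z x lz zx ltac:(lra) _ r rI).
- move=> y /andP[zy yx]; apply/andP; split.
    move: zy; rewrite le_eqVlt => /orP[/eqP <-|zy]; first by rewrite !Gz.
    by apply/ltW/side; rewrite zy /=; lra.
  apply: le_trans Gxx; apply: (incr_le sd zy yx); lra.
- by move=> /andP[]; lra.
- move=> [y /andP[zy yx] e].
  have /etaP : `|y - z| < eta by rewrite ger0_norm; lra.
  by rewrite e gtr0_norm // ltxx.
Qed.

(** By transitivity the union of the iterated images of [[u, v]] is dense. Each image is an interval
    containing [z], so it also contains every point between [z] and any of its points. *)
Let dense_orbit z u v x : G z = z -> l <= u -> u < v -> v <= r -> u <= z <= v ->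
  l < x < r -> exists i, exists2 y, u <= y <= v & iter i G y = x.
Proof.
move=> Gz lu uv vr zuv /andP[lx xr].
pose U := [set x | exists i, exists2 y, u <= y <= v & iter i G y = x].
have Ulr : U `<=` `[l, r].
  move=> _ [i [y /andP[uy yv] <-]]; rewrite /= in_itv /=.
  by apply: iter_inv; apply/andP; split; lra.
have Uinv t : U t -> U (G t) by move=> [i [y yuv <-]]; exists i.+1, y.
have dense : `[l, r] `<=` closure U.
  apply: (@G_trans (closure U) _ _ _ u v uv).
  - exact: closed_closure.
  - have /closure_id e : closed (`[l, r]%classic : set R) by exact: itv_closed.
    by rewrite [X in _ `<=` X]e; exact: closure_subset.
  - exact: closure_invariant.
  - by move=> y; rewrite /= in_itv /= => yuv; apply: subset_closure; exists 0%N, y.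
have [lr' zlr] : l <= r /\ l <= z <= r.
  by case/andP: zuv => ? ?; split; [lra|apply/andP; split; lra].
have [xz|/ltW zx] := leP x z.
  have [_ [[i [y yuv <-]]]] : exists p, U p /\ p < x.
    have cl : closure U l by apply: dense; rewrite /= in_itv /= lexx.
    have [p [Up px]] := cl _ (lt_nbhsl lx); by exists p.
  move=> yx; have [|t tuv <-] := cont_surj_segment (c := x) (@iter_cont i) yuv zuv.
    by rewrite (fix_iter i Gz) xz ltW.
  by exists i, t.
have [_ [[i [y yuv <-]]]] : exists p, U p /\ x < p.
  have cl : closure U r by apply: dense; rewrite /= in_itv /= lexx andbT.
  have [p [Up px]] := cl _ (lt_nbhsr xr); by exists p.
move=> xy; have [|t tuv <-] := cont_surj_segment (c := x) (@iter_cont i) zuv yuv.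
  by rewrite (fix_iter i Gz) zx ltW.
by exists i, t.
Qed.

(** Only [l] and [r] can be missed by the iterated images of [[u, v]], and a missed point has only
    missed preimages. If [w] were missed, it would be periodic of period at most 2 with a missed
    orbit, yet that orbit contains [z]. *)
Let orbit_reaches z w k u v : G z = z -> l <= w <= r -> w != z ->
  iter k G w = z -> l <= u -> u < v -> v <= r -> u <= z <= v ->
  exists i, exists2 y, u <= y <= v & iter i G y = w.
Proof.
move=> Gz wlr wz Gkw lu uv vr zuv; apply: contrapT => nU.
pose U x := exists i, exists2 y, u <= y <= v & iter i G y = x.
have Uint x : l <= x <= r -> ~ U x -> x = l \/ x = r.
  move=> /andP[]; rewrite !le_eqVlt => /orP[/eqP ->|lx]; first by left.
  move=> /orP[/eqP ->|xr]; first by right.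
  by case; apply: dense_orbit Gz lu uv vr zuv _; rewrite lx.
have back x : l <= x <= r -> ~ U x -> exists y, [/\ l <= y <= r, ~ U y & G y = x].
  move=> /G_surj[y ylr <-] nUx; exists y; split => //.
  by move=> [i [t tuv et]]; apply: nUx; exists i.+1, t => //=; rewrite et.
have [w1 [w1lr nUw1 Gw1]] := back w wlr nU.
have [w2 [w2lr nUw2 Gw2]] := back w1 w1lr nUw1.
have ew := Uint _ wlr nU; have ew1 := Uint _ w1lr nUw1; have ew2 := Uint _ w2lr nUw2.
have zU : U z by exists 0%N, z.
have [e1|ne1] := eqVneq w1 w.
  by rewrite e1 in Gw1; move: wz; rewrite -Gkw (fix_iter k Gw1) eqxx.
have Gw : G w = w1.
  have [e2|ne2] := eqVneq w2 w1.
    by rewrite e2 in Gw2; case/eqP: ne1; rewrite -Gw1 Gw2.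
  suff -> : w = w2 by [].
  by case: ew ew1 ew2 ne1 ne2 => -> [] -> [] ->; rewrite ?eqxx.
have : iter k G w = w \/ iter k G w = w1.
  by elim: (k) => [|j [] e]; [left|right; rewrite iterS e|left; rewrite iterS e].
by rewrite Gkw => -[] e; [apply: nU|apply: nUw1]; rewrite -e.
Qed.

Lemma transitive_horseshoe : exists N, (0 < N)%N /\ exists c, forall q,
  exists s : seq R, [/\ uniq s, size s = (2 ^ q)%N &
    {in s, forall t, l <= t <= r /\ iter (N * q) G t = c}].
Proof.
have [z zlr Gz] := fixpoint.
have [w [k [wlr wz Gkw]]] := homoclinic zlr Gz.
have {zlr} [lz zr] : l <= z /\ z <= r by case/andP: zlr => ? ?; split; lra.
case/andP: (wlr) => lw wr.
have reach := @orbit_reaches z w k _ _ Gz wlr wz Gkw.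
pose x := Num.min z w; pose y := Num.max z w.
have [xz xw zy wy [lx yr]] : [/\ x <= z, x <= w, z <= y, w <= y & l <= x /\ y <= r].
  by rewrite /x /y; case: (leP z w) => ?; split; lra.
have onto g u v t1 t2 : continuous g -> u <= t1 <= v -> u <= t2 <= v ->
    g t1 = z -> g t2 = w -> covers g u v x y.
  move=> gc t1i t2i e1 e2 c /andP[xc cy].
  have [zw|wz'] := leP z w.
    apply: (cont_surj_segment gc t1i t2i); rewrite e1 e2.
    by move: xc cy; rewrite /x /y (min_l zw) (max_r zw) => -> ->.
  apply: (cont_surj_segment gc t2i t1i); rewrite e1 e2.
  by move: xc cy; rewrite /x /y (min_r (ltW wz')) (max_l (ltW wz')) => -> ->.
(* The two intervals are the outer thirds of the segment joining [z] and [w]. *)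
have [u1 [v1 [u2 [v2 [[xu1 uv1 v1y] [xu2 uv2 v2y] zJ wJ dis]]]]] :
    exists u1 v1 u2 v2, [/\ [/\ x <= u1, u1 < v1 & v1 <= y],
      [/\ x <= u2, u2 < v2 & v2 <= y], u1 <= z <= v1, u2 <= w <= v2 &
      v1 < u2 \/ v2 < u1].
  have [zw|wz'|e] := ltgtP z w; last by rewrite e eqxx in wz.
    exists z, ((2 * z + w) / 3), ((z + 2 * w) / 3), w.
    by split; [split|split|apply/andP; split|apply/andP; split|left]; lra.
  exists ((2 * z + w) / 3), z, w, ((z + 2 * w) / 3).
  by split; [split|split|apply/andP; split|apply/andP; split|right]; lra.
(* The iterate of order [i1] fixes [z] and sends [t1] to [w], so it maps the third at [z] over the
   whole segment. *)
have [i1 [t1 t1J e1]] := reach u1 v1 ltac:(lra) uv1 ltac:(lra) zJ.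
have c1 : covers (iter i1 G) u1 v1 x y.
  exact: onto (@iter_cont i1) zJ t1J (fix_iter i1 Gz) e1.
have i1_gt0 : (0 < i1)%N.
  case: (i1) e1 => //= e1; exfalso.
  by move: t1J wJ; rewrite e1 => /andP[? ?] /andP[? ?]; case: dis; lra.
have k_gt0 : (0 < k)%N by case: (k) Gkw => //= e; rewrite e eqxx in wz.
(* As [iter k G] sends [w] to [z] and is not constant on the third at [w], its image there is an
   interval with [z] in it, some point of which later reaches [w]. *)
have [p pJ pz] : exists2 p, u2 <= p <= v2 & iter k G p != z.
  have [t /andP[u2t tv2] st] := @iter_nonconst k u2 v2 ltac:(lra) uv2 ltac:(lra).
  have [e|] := eqVneq (iter k G u2) z; last by exists u2 => //; rewrite lexx ltW.
  exists t; first by rewrite tv2 ltW.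
  rewrite -e; apply/eqP => e'; suff : t = u2 by lra.
  by apply: (smono_inj st) => //; rewrite lexx ltW.
have [i2 [t2 t2J e2]] : exists i, exists2 t, u2 <= t <= v2 & iter (i + k) G t = w.
  have plr : l <= p <= r by case/andP: pJ => ? ?; apply/andP; split; lra.
  case/andP: (iter_inv k plr) => lp pr.
  have [zp|pz'|e] := ltgtP z (iter k G p); last by rewrite e eqxx in pz.
    have [|i [t tI et]] := reach z (iter k G p) lz zp pr.
      by rewrite lexx ltW.
    have [|t' t'J et'] := cont_surj_segment (c := t) (@iter_cont k) wJ pJ.
      by rewrite Gkw.
    by exists i, t' => //; rewrite iterD et'.
  have [|i [t tI et]] := reach (iter k G p) z lp pz' zr.
    by rewrite lexx andbT ltW.
  have [|t' t'J et'] := cont_surj_segment (c := t) (@iter_cont k) pJ wJ.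
    by rewrite Gkw.
  by exists i, t' => //; rewrite iterD et'.
have c2 : covers (iter (i2 + k) G) u2 v2 x y.
  apply: onto (@iter_cont (i2 + k)) wJ t2J _ e2.
  by rewrite iterD Gkw fix_iter.
have iterM n m t : iter n (iter m G) t = iter (n * m) G t.
  by elim: n => //= n ->; rewrite mulSn iterD.
(* A common multiple of the two covering times. *)
exists (i1 * (i2 + k))%N; split; first by rewrite muln_gt0 i1_gt0 addn_gt0 k_gt0 orbT.
exists x => q.
have C1 : covers (iter (i1 * (i2 + k)) G) u1 v1 x y.
  move=> c /(covers_iter ((i2 + k).-1) xu1 v1y c1) [t tJ <-]; exists t => //.
  by rewrite iterM prednK ?addn_gt0 ?k_gt0 ?orbT // mulnC.
have C2 : covers (iter (i1 * (i2 + k)) G) u2 v2 x y.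
  move=> c /(covers_iter (i1.-1) xu2 v2y c2) [t tJ <-]; exists t => //.
  by rewrite iterM prednK.
have xy : x <= x <= y by rewrite lexx; lra.
have [s [us ss hs]] := horseshoe_fiber xu1 v1y xu2 v2y dis C1 C2 q xy.
exists s; split => // t /hs [/andP[xt ty] <-]; split.
  by apply/andP; split; lra.
by rewrite iterM mulnC.
Qed.

End Horseshoe.

(** * Injectivity of the semiconjugacy *)

Section Clamp.
Context {R : realType} (a b : R).
Hypothesis hab : a < b.

(** Composition with [clamp] extends a continuous map of [[a, b]] to the whole line without new
    values, so that continuity can be stated globally. *)
Definition clamp (x : R) : R := Num.max a (Num.min b x).

Lemma clamp_in x : a <= clamp x <= b.
Proof. by rewrite /clamp le_max lexx /= ge_max (ltW hab) ge_min lexx. Qed.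

Lemma clamp_id x : a <= x <= b -> clamp x = x.
Proof. by move=> /andP[ax xb]; rewrite /clamp (min_r xb) (max_r ax). Qed.

Lemma clamp_continuous : continuous clamp.
Proof.
move=> x; apply: (@continuous_max R R (cst a) (fun y => Num.min b y) x).
  exact: cvg_cst.
apply: (@continuous_min R R (cst b) id x); [exact: cvg_cst|exact: cvg_id].
Qed.

Lemma continuous_comp_clamp (f : R -> R) :
  {within `[a, b], continuous f} -> continuous (f \o clamp).
Proof.
move=> /subspace_continuousP fc x N /= Nf.
have cI : `[a, b]%classic (clamp x) by rewrite /= in_itv /= clamp_in.
have H : nbhs (clamp x) [set y | `[a, b]%classic y -> N (f y)] by exact: fc _ cI _ Nf.
have {}H : nbhs x [set y | `[a, b]%classic (clamp y) -> N (f (clamp y))].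
  exact: clamp_continuous H.
change (nbhs x [set y | N (f (clamp y))]); apply: filterS H => y; apply.
by rewrite /= in_itv /= clamp_in.
Qed.

End Clamp.

(** * Countability arguments *)

Section Countable.
Context {R : realType}.
Implicit Types (F kappa : R -> R) (x y : R) (n : nat).

Lemma uncountable_segment x y : x < y -> ~ countable `[x, y]%classic.
Proof.
move=> xy /countable_lebesgue_measure0; rewrite lebesgue_measure_itv /= lte_fin xy.
by rewrite -EFinB => /eqP; rewrite eqe subr_eq0 gt_eqF.
Qed.

(** On each piece [kappa \o F] determines [kappa], so every value of [kappa] on [S] accounts for at
    most one value per piece. It serves with [kappa] equal to [psi] and to the identity. *)
Lemma countable_preimage F kappa n x y (S : set R) :
  (forall u v, x <= u -> u <= v -> v <= y -> smono F u v ->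
    forall s t, u <= s <= v -> u <= t <= v -> kappa (F s) = kappa (F t) ->
    kappa s = kappa t) ->
  pieces F n x y -> countable (kappa @` S) ->
  countable (kappa @` [set t | x <= t <= y /\ S (F t)]).
Proof.
elim: n x => [x _ /= -> cS|n IH x inj [m [xm my s p]] cS].
  apply: (@sub_countable _ _ _ [set kappa y]); last exact: countable1.
  by apply: subset_card_le => _ [t [/andP[ty yt] _] <-] /=; congr kappa; lra.
(* The default 0 is harmless: [h] matters only at values [v] attained by [kappa \o F] on the
   piece. *)
pose h v := kappa (xget 0 [set t | x <= t <= m /\ kappa (F t) = v]).
apply: (@sub_countable _ _ _ (h @` (kappa @` S) `|`
    kappa @` [set t | m <= t <= y /\ S (F t)])).
  apply: subset_card_le => _ [t [/andP[xt ty] St] <-].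
  have [tm|mt] := leP t m; last first.
    by right; exists t => //; split=> //; rewrite ty (ltW mt).
  left; exists (kappa (F t)); first by exists (F t).
  rewrite /h; case: xgetP => [t' _ [t'I e]|/(_ t) []]; last by rewrite /= xt tm.
  by apply: (inj x m) => //; rewrite ?xt ?tm.
rewrite -bigcup2E; apply: bigcup_countable => // -[|[|i]] _ //=.
  by apply: sub_countable cS; exact: card_image_le.
apply: IH => // u v mu; apply: inj; lra.
Qed.

End Countable.

(** * Continuity of the semiconjugacy *)

Section Continuity.
Context {R : realType} (a b : R) (F : R -> R) (beta : R) (psi : R -> R).
Hypotheses (hab : a < b) (F_cont : continuous F)
  (F_in : forall x, a <= F x <= b) (F_pm : exists n, pieces F n a b)
  (beta1 : 1 < beta)
  (psi_mono : forall x y, a <= x -> x <= y -> y <= b -> psi x <= psi y)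
  (psi_contr : forall x y m, a <= x -> x <= y -> y <= b ->
      psi y - psi x <= (lapc (iter m F) x y)%:R / beta ^+ m).

(** On a strictly monotone piece of [iter m F], [psi] varies by at most [beta^-m], and each point
    has one-sided neighborhoods inside such pieces. *)
Lemma semiconjugacy_continuous : {within `[a, b], continuous psi}.
Proof.
have b1 := beta1; have b0 : 0 < beta by lra.
apply/subspace_continuousP => x; rewrite /= in_itv /= => /andP[ax xb].
apply/cvgrPdist_lt => e e0.
have [m me] : exists m, (beta^-1) ^+ m < e.
  have : `|beta^-1| < 1 by rewrite gtr0_norm ?invr_gt0 // invf_lt1.
  move=> /cvg_expr/cvgrPdist_lt /(_ _ e0)[N _ /(_ N (leqnn _))] h; exists N.
  by move: h; rewrite /= sub0r normrN ger0_norm // exprn_ge0 // invr_ge0 ltW.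
have [n pn] := pieces_iter hab F_cont F_in F_pm m.
have osc u v : a <= u -> u <= v -> v <= b -> smono (iter m F) u v ->
    psi v - psi u < e.
  move=> au uv vb s; apply: le_lt_trans (psi_contr m au uv vb) _.
  apply: le_lt_trans me; rewrite exprVn -[leRHS]mul1r ler_pM2r ?invr_gt0 ?exprn_gt0 //.
  by rewrite lern1; apply/lapc_le/pieces1.
have [dr dr0 hr] : exists2 d, 0 < d &
    forall t, x <= t -> t < x + d -> t <= b -> psi t - psi x < e.
  have [xb'|bx] := ltP x b; last first.
    exists 1 => // t xt _ tb; have -> : t = x by lra.
    by rewrite subrr.
  have [w /andP[xw wb] sw] := pieces_nonconst_right xb' (pieces_sub pn ax xb (lexx b)).
  exists (w - x); first lra; move=> t xt tw tb; apply: osc => //.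
  by apply: (smono_sub sw) => //; lra.
have [dl dl0 hl] : exists2 d, 0 < d &
    forall t, t <= x -> x - d < t -> a <= t -> psi x - psi t < e.
  have [ax'|xa] := ltP a x; last first.
    exists 1 => // t xt _ ta; have -> : t = x by lra.
    by rewrite subrr.
  have [w /andP[aw wx] sw] := pieces_nonconst_left ax' (pieces_sub pn (lexx a) ax xb).
  exists (x - w); first lra; move=> t xt tw tb; apply: osc => //.
  by apply: (smono_sub sw) => //; lra.
rewrite /within /= near_withinE; apply/nbhs_ballP.
exists (Num.min dr dl) => /=; first by rewrite lt_min dr0.
move=> t; rewrite /ball /= lt_min !ltr_norml => /andP[/andP[h1 h2] /andP[h3 h4]].
rewrite in_itv /= => /andP[at' tb];
change (- e < psi x - psi t < e).
have [xt|tx] := leP x t.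
  have h : psi x <= psi t by exact: psi_mono.
  by have := hr t xt ltac:(lra) tb; move=> ?; apply/andP; split; lra.
have h : psi t <= psi x by apply: psi_mono => //; exact: ltW.
by have := hl t (ltW tx) ltac:(lra) at'; move=> ?; apply/andP; split; lra.
Qed.

End Continuity.

(** * Strict monotonicity of the semiconjugacy *)

Section Injectivity.
Context {R : realType} (a b : R) (F : R -> R) (beta : R) (psi : R -> R).
Hypotheses (hab : a < b) (F_cont : continuous F)
  (F_in : forall x, a <= F x <= b) (F_pm : exists n, pieces F n a b)
  (beta_gt0 : 0 < beta) (psi_a : psi a = 0) (psi_b : psi b = 1)
  (psi_mono : forall x y, a <= x -> x <= y -> y <= b -> psi x <= psi y)
  (psi_cont : {within `[a, b], continuous psi})
  (psi_incr : forall x y, a <= x -> x <= y -> y <= b -> incr F x y ->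
    psi (F y) - psi (F x) = beta * (psi y - psi x))
  (psi_decr : forall x y, a <= x -> x <= y -> y <= b -> decr F x y ->
    psi (F x) - psi (F y) = beta * (psi y - psi x)).
Variables (C : set R) (m : nat) (l r : nat -> R).
Hypotheses (C_closed : closed C) (C_sub : C `<=` `[a, b])
  (C_inv : forall x, C x -> C (F x))
  (C_trans : forall X : set R, closed X -> X `<=` C ->
    (forall x, X x -> X (F x)) -> X = C \/ interior X = set0)
  (C_itv : C = \bigcup_(k < m) `[l k, r k]%classic)
  (C_abs : countable (`[a, b] `\` [set x | exists n, C (iter n F x)])).

Implicit Types (x y u v s t : R) (n k : nat).

Let piece_eq x y s t : a <= x -> x <= y -> y <= b -> smono F x y ->
  x <= s <= y -> x <= t <= y -> (psi (F s) = psi (F t)) <-> (psi s = psi t).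
Proof.
move=> ax xy yb sF.
have b0 := beta_gt0.
wlog st : s t / s <= t.
  move=> W si ti; have [/W|/ltW/W h] := leP s t; first exact.
  have {}h := h ti si.
  by split => e; apply/esym/h.
move=> /andP[xs sy] /andP[xt ty].
have as' : a <= s by lra.
have tb : t <= b by lra.
have E (p q : R) : p = beta * q -> (p = 0 <-> q = 0).
  move=> ->; split=> [/eqP|->]; last by rewrite mulr0.
  by rewrite mulf_eq0 gt_eqF //= => /eqP.
case: sF => sF.
  have fi : incr F s t by move=> u v ? ? ?; apply: sF => //; lra.
  by have [h1 h2] := E _ _ (psi_incr as' st tb fi); split => e; lra.
have fi : decr F s t by move=> u v ? ? ?; apply: sF => //; lra.
by have [h1 h2] := E _ _ (psi_decr as' st tb fi); split => e; lra.
Qed.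

(** By monotonicity [psi] is constant on [[x, y]], hence so is [psi \o F], piece after piece. Thus
    [F] descends to the quotient that [psi] defines. *)
Let psi_factor x y : a <= x <= b -> a <= y <= b -> psi x = psi y ->
  psi (F x) = psi (F y).
Proof.
wlog xy : x y / x <= y.
  move=> W xi yi; have [/W|/ltW/W h] := leP x y; first exact.
  by move=> /esym/(h yi xi)/esym.
move=> /andP[ax xb] /andP[ay yb].
have [n pn] := F_pm; have {pn} := pieces_sub pn ax xy yb.
elim: n x ax xb xy => [x ax xb xy -> //|n IH x ax xb xy [w [xw wy s p]] e].
have h1 : psi x <= psi w by apply: psi_mono => //; lra.
have h2 : psi w <= psi y by apply: psi_mono => //; lra.
have -> : psi (F x) = psi (F w).
  by apply/(piece_eq ax xw (le_trans wy yb) s); rewrite ?lexx ?xw //; lra.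
by apply: IH => //; lra.
Qed.

Let psi_iter n x y : a <= x <= b -> a <= y <= b -> psi x = psi y ->
  psi (iter n F x) = psi (iter n F y).
Proof.
move=> xi yi e; elim: n => //= n IH.
by apply: psi_factor => //; apply: iter_in.
Qed.

Let psi_surj c : 0 <= c <= 1 -> exists2 x, a <= x <= b & psi x = c.
Proof.
move=> /andP[c0 c1].
have [|x] := @IVT R psi a b c (ltW hab) psi_cont.
  by rewrite psi_a psi_b min_l ?max_r ?ler01 // c0.
by rewrite in_itv /= => xi <-; exists x.
Qed.

Let psi_C_uncountable : ~ countable (psi @` C).
Proof.
move=> cC; have [n0 p0] := F_pm.
have cP n : countable (psi @` [set x | a <= x <= b /\ C (iter n F x)]).
  elim: n => [|n IH].
    apply: sub_countable cC; apply: subset_card_le => _ [x [_ Cx] <-].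
    by exists x.
  have inj u v : a <= u -> u <= v -> v <= b -> smono F u v ->
      forall s t, u <= s <= v -> u <= t <= v -> psi (F s) = psi (F t) ->
      psi s = psi t.
    by move=> au uv vb sF s t si ti /(piece_eq au uv vb sF si ti).
  apply: sub_countable (countable_preimage inj p0 IH).
  apply: subset_card_le => _ [x [xi Cx] <-]; exists x => //; split => //.
  by split; [exact: F_in|rewrite -iterSr].
have : countable (psi @` `[a, b]).
  apply: (@sub_countable _ _ _ ((\bigcup_n psi @` [set x | a <= x <= b /\ C (iter n F x)])
    `|` psi @` (`[a, b] `\` [set x | exists n, C (iter n F x)]))).
    apply: subset_card_le => _ [x + <-]; rewrite /= in_itv /= => xi.
    have [[n Cn]|nC] := pselect (exists n, C (iter n F x)).
      by left; exists n => //; exists x.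
    by right; exists x => //; split; rewrite /= ?in_itv.
  rewrite -bigcup2E; apply: bigcup_countable => // -[|[|i]] _ //=.
    exact: bigcup_countable.
  by apply: sub_countable C_abs; exact: card_image_le.
move=> h; apply: (@uncountable_segment R 0 1 ltr01).
apply: sub_countable h; apply: subset_card_le => c.
rewrite /= in_itv /= => /psi_surj[x xi <-]; exists x => //.
Qed.

Let psi_C_inj u v : u < v -> `[u, v] `<=` C -> psi u != psi v.
Proof.
move=> uv uvC; apply/eqP => e; apply: psi_C_uncountable.
have Cab x : C x -> a <= x <= b by move=> /C_sub; rewrite /= in_itv.
have uC : C u by apply: uvC; rewrite /= in_itv /= lexx ltW.
have vC : C v by apply: uvC; rewrite /= in_itv /= lexx ltW.
have /andP[au ub] := Cab _ uC; have /andP[av vb] := Cab _ vC.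
have const y : u <= y <= v -> psi y = psi u.
  move=> /andP[uy yv].
  have h1 : psi u <= psi y by apply: psi_mono => //; lra.
  have h2 : psi y <= psi v by apply: psi_mono => //; lra.
  lra.
(* Iterates start at 1, so that a point of [U] in [[u, v]] yields a positive return time. *)
pose U := [set x | exists n, exists2 y, u <= y <= v & iter n.+1 F y = x].
have Cit n y : C y -> C (iter n F y) by move=> Cy; elim: n => //= n; exact: C_inv.
have UC : U `<=` C.
  by move=> _ [n [y yI <-]]; apply: Cit; apply: uvC; rewrite /= in_itv.
have Uinv x : U x -> U (F x) by move=> [n [y yI <-]]; exists n.+1, y.
(* Transitivity applies: [F] maps a strictly monotone piece of [[u, v]] onto a nondegenerate
   interval contained in [U]. *)
have clU : closure U = C.
  have clC : closure U `<=` C.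
    have /closure_id eC := C_closed.
    by rewrite [X in _ `<=` X]eC; exact: closure_subset.
  have [//|] := C_trans (@closed_closure _ U) clC (closure_invariant F_cont Uinv).
  have [n0 p0] := F_pm.
  have [w /andP[uw wv] sw] :=
    pieces_nonconst_right uv (pieces_sub p0 au (ltW uv) vb).
  have [p [q [pq pqU]]] : exists p q, p < q /\ forall c, p < c < q -> U c.
    have uI : u <= u <= v by rewrite lexx ltW.
    have wI : u <= w <= v by rewrite ltW.
    case: sw => sw.
      exists (F u), (F w); split; first exact: sw.
      move=> c /andP[uc cw]; exists 0%N.
      by apply: (cont_surj_segment F_cont uI wI); rewrite !ltW.
    exists (F w), (F u); split; first exact: sw.
    move=> c /andP[uc cw]; exists 0%N.
    by apply: (cont_surj_segment F_cont wI uI); rewrite !ltW.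
  have : interior (closure U) ((p + q) / 2).
    apply: (@filterS _ _ _ `]p, q[%classic).
      by move=> c; rewrite /= in_itv /= => /pqU; exact: subset_closure.
    by apply: near_in_itvoo; rewrite in_itv /=; apply/andP; split; lra.
  by move=> + e0; rewrite e0.
have [n [y yI [uy yv]]] : exists n, exists2 y, u <= y <= v &
    u <= iter n.+1 F y /\ iter n.+1 F y <= v.
  have : closure U ((u + v) / 2).
    by rewrite clU; apply: uvC; rewrite /= in_itv /=; apply/andP; split; lra.
  move=> /(_ `]u, v[%classic) [].
    by apply: near_in_itvoo; rewrite in_itv /=; apply/andP; split; lra.
  move=> _ [[n [y yI <-]]]; rewrite /= in_itv /= => /andP[? ?].
  by exists n, y => //; split; exact: ltW.
pose q := n.+1.
have Iab t : u <= t <= v -> a <= t <= b.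
  by move=> /andP[? ?]; apply/andP; split; lra.
have uI : u <= u <= v by rewrite lexx ltW.
have ret t : u <= t <= v -> psi (iter q F t) = psi u.
  move=> tI; have -> : psi (iter q F t) = psi (iter q F y).
    by apply: psi_iter; [exact: Iab|exact: Iab|rewrite !const].
  by apply: const; rewrite uy yv.
(* As [psi] takes the value [psi u] again after [q] steps, its value along an orbit starting in
   [[u, v]] depends only on the time modulo [q]. *)
have per j t : u <= t <= v -> psi (iter j F t) = psi (iter (j %% q) F u).
  elim/ltn_ind: j t => j IH t tI.
  have [jq|qj] := ltnP j q.
    by rewrite modn_small //; apply: psi_iter; [exact: Iab|exact: Iab|exact: const].
  rewrite -{1}(subnK qj) iterD.
  have -> : psi (iter (j - q) F (iter q F t)) = psi (iter (j - q) F u).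
    by apply: psi_iter; [apply: iter_in => //; exact: Iab|exact: Iab|exact: ret].
  rewrite IH //; last by rewrite ltn_subrL (leq_trans _ qj).
  by rewrite -{2}(subnK qj) modnDr.
pose Y := [set psi (iter i F u) | i in `I_q].
have Yfin : finite_set Y by apply: finite_image; exact: finite_II.
apply: finite_set_countable; apply: (sub_finite_set _ Yfin) => _ [x Cx <-].
(* The preimage of the finite set [Y] under the continuous [Psi] is closed and contains [U], hence
   contains [C]. *)
pose Psi := psi \o clamp a b.
have PsiE t : a <= t <= b -> Psi t = psi t by move=> ti; rewrite /Psi /= clamp_id.
have clX : closed (Psi @^-1` Y).
  apply: preimage_closed; last first.
    by apply: (accessible_finite_set_closed.1 _) Yfin; exact/hausdorff_accessible/Rhausdorff.
  by move=> t _; exact: continuous_comp_clamp.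
have : closure U `<=` Psi @^-1` Y.
  rewrite [X in _ `<=` X]((closure_id _).1 clX); apply: closure_subset.
  move=> _ [j [t tI <-]]; rewrite /preimage /= PsiE; last exact: F_in.
  by exists (j.+1 %% q)%N; rewrite -?(per j.+1 t tI) //= ltn_pmod.
by move=> /(_ x); rewrite clU => /(_ Cx); rewrite /preimage /= PsiE //; exact: Cab.
Qed.

Lemma semiconjugacy_inj x y : a <= x -> x < y -> y <= b -> psi x < psi y.
Proof.
move=> ax xy yb; rewrite lt_neqAle psi_mono // ?ltW // andbT; apply/eqP => e.
have [n0 p0] := F_pm.
have const t : x <= t <= y -> psi t = psi x.
  move=> /andP[xt ty].
  have h1 : psi x <= psi t by apply: psi_mono => //; lra.
  have h2 : psi t <= psi y by apply: psi_mono => //; lra.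
  lra.
have Iab t : x <= t <= y -> a <= t <= b.
  by move=> /andP[? ?]; apply/andP; split; lra.
(* Fibers of iterates are finite, so preimages of countable sets stay countable; here [kappa] is the
   identity. *)
have cpre n (S : set R) : countable S ->
    countable [set t | a <= t <= b /\ S (iter n F t)].
  move=> cS; elim: n => [|n IH].
    by apply: sub_countable cS; apply: subset_card_le => t [].
  rewrite -[X in countable X]image_id.
  have inj u v : a <= u -> u <= v -> v <= b -> smono F u v ->
      forall s t, u <= s <= v -> u <= t <= v -> id (F s) = id (F t) ->
      id s = id t.
    by move=> _ _ _ sF s t si ti; apply: smono_inj sF si ti.
  have IH' : countable (id @` [set t | a <= t <= b /\ S (iter n F t)]).
    by rewrite image_id.
  apply: sub_countable (countable_preimage inj p0 IH').
  apply: subset_card_le => _ [t [ti St] <-]; exists t => //; split => //.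
  by split; [exact: F_in|rewrite -iterSr].
have cW n k : (k < m)%N ->
    countable [set t | x <= t <= y /\ `[l k, r k]%classic (iter n F t)].
  move=> km; pose S := iter n F @`
    [set t | x <= t <= y /\ `[l k, r k]%classic (iter n F t)].
  (* Two points of the image in one component of [C] would bound an interval in [C] with equal [psi]
     values at its ends, against [psi_C_inj]. *)
  have sub p q : S p -> S q -> p < q -> False.
    move=> [s [sI +] es] [t [tI +] et] pq; rewrite es et /= !in_itv /=.
    move=> /andP[lp pr] /andP[lq qr].
    have pqC : `[p, q] `<=` C.
      move=> c; rewrite C_itv /= in_itv /= => /andP[pc cq]; exists k => //=.
      by rewrite in_itv /=; apply/andP; split; lra.
    have /eqP := psi_C_inj pq pqC; apply.
    rewrite -es -et; apply: psi_iter; [exact: Iab|exact: Iab|].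
    by rewrite !const.
  have cS : countable S.
    have [[p Sp]|nS] := pselect (exists p, S p); last first.
      apply: (@sub_countable _ _ _ (set0 : set R)); last exact: countable0.
      by apply: subset_card_le => p Sp; apply: nS; exists p.
    apply: (@sub_countable _ _ _ [set p]); last exact: countable1.
    apply: subset_card_le => q Sq; case: (ltgtP q p) => // h.
      by case: (sub _ _ Sq Sp h).
    by case: (sub _ _ Sp Sq h).
  apply: sub_countable (cpre n S cS); apply: subset_card_le => t [tI tk].
  by split; [exact: Iab|exists t].
apply: (@uncountable_segment R x y xy).
apply: (@sub_countable _ _ _ ((\bigcup_n \bigcup_(k < m)
    [set t | x <= t <= y /\ `[l k, r k]%classic (iter n F t)])
    `|` (`[a, b] `\` [set x | exists n, C (iter n F x)]))).
  apply: subset_card_le => t; rewrite /= in_itv /= => tI.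
  have [[n Cn]|nC] := pselect (exists n, C (iter n F t)).
    by left; exists n => //; move: Cn; rewrite C_itv => -[k km h]; exists k.
  by right; split; rewrite /= ?in_itv //=; exact: Iab.
rewrite -bigcup2E; apply: bigcup_countable => // -[|[|i]] _ //=.
by apply: bigcup_countable => // n _; apply: bigcup_countable => // k; exact: cW.
Qed.

End Injectivity.

(** * Entropy and conjugacy *)

Section Entropy.
Context {R : realType} (a b : R) (F : R -> R).
Hypotheses (hab : a < b) (F_cont : continuous F)
  (F_in : forall x, a <= F x <= b) (F_pm : exists n, pieces F n a b).
Implicit Types (x y u v : R) (n k i : nat).

Local Notation L k x y := (lapc (iter k F) x y).

(** The horseshoe of the return map [iter m F] on the first interval of the cycle has fibers of size
    [2 ^ n], and a fiber is no larger than the number of pieces. *)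
Lemma cycle_lap_growth (C : set R) m (l r : nat -> R) : (0 < m)%N ->
  C `<=` `[a, b] -> (forall X : set R, closed X -> X `<=` C ->
    (forall x, X x -> X (F x)) -> X = C \/ interior X = set0) ->
  C = \bigcup_(k < m) `[l k, r k]%classic ->
  (forall k, (k < m)%N -> l k < r k) ->
  trivIset `I_m (fun k => `[l k, r k]%classic) ->
  (forall k x, (k.+1 < m)%N -> l k <= x <= r k -> l k.+1 <= F x <= r k.+1) ->
  (forall x, l m.-1 <= x <= r m.-1 -> l 0%N <= F x <= r 0%N) ->
  exists2 M, (0 < M)%N & forall n, (2 ^ n <= L (n * M) a b)%N.
Proof.
move=> m0 Cab Ctr CE lr tr step last.
have lr0 := lr 0%N m0.
have [al rb] : a <= l 0%N /\ r 0%N <= b.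
  have h t : l 0%N <= t <= r 0%N -> a <= t <= b.
    by move=> tI; have := Cab t; rewrite CE /= in_itv /=; apply; exists 0%N => //=; rewrite in_itv.
  have /andP[al _] := h _ (introT andP (conj (lexx (l 0%N)) (ltW lr0))).
  have /andP[_ rb] := h _ (introT andP (conj (ltW lr0) (lexx (r 0%N)))).
  by [].
have orb i x : (i < m)%N -> l 0%N <= x <= r 0%N -> l i <= iter i F x <= r i.
  move=> + xi; elim: i => // i IH im.
  by apply: step => //; apply: IH; apply: ltnW.
have Gin x : l 0%N <= x <= r 0%N -> l 0%N <= iter m F x <= r 0%N.
  move=> xi; rewrite -(prednK m0) /=; apply: last; apply: orb => //.
  by rewrite prednK.
have Gpm k : exists n, pieces (iter k (iter m F)) n (l 0%N) (r 0%N).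
  have [n pn] := pieces_iter hab F_cont F_in F_pm (k * m); exists n.
  apply: (@pieces_ext _ (iter (k * m) F)); last exact: pieces_sub pn al (ltW lr0) rb.
  by move=> u _; elim: k {pn} => //= k <-; rewrite mulSn iterD.
(* The union [Y] of the first [m] images of [X] is closed, invariant and has interior, so [Y = C].
   The intervals of the cycle being disjoint, only [X] itself meets the first one. *)
have Gtr (X : set R) : closed X -> X `<=` `[l 0%N, r 0%N] ->
    (forall x, X x -> X (iter m F x)) -> forall u v, u < v ->
    `[u, v] `<=` X -> `[l 0%N, r 0%N] `<=` X.
  move=> Xcl Xsub Xinv u v uv uvX.
  have Xi x : X x -> l 0%N <= x <= r 0%N by move/Xsub; rewrite /= in_itv.
  have Xcomp : compact X by apply: subclosed_compact Xcl (@segment_compact _ _ _) Xsub.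
  pose Y := \bigcup_(i < m) (iter i F @` X).
  have Ycl : closed Y.
    apply: closed_bigcup; first exact: finite_II.
    move=> i _; apply: compact_closed; first exact: Rhausdorff.
    apply: continuous_compact => //; apply: continuous_subspaceT.
    exact: continuous_iter.
  have YC : Y `<=` C.
    move=> _ [i im [x Xx <-]]; rewrite CE; exists i => //=.
    by rewrite in_itv /=; apply: orb => //; exact: Xi.
  have Yinv x : Y x -> Y (F x).
    move=> [i /= im [t Xt <-]]; have [im'|im'] := ltnP i.+1 m.
      by exists i.+1 => //; exists t.
    have e : i.+1 = m by lia.
    by exists 0%N => //; exists (iter m F t); [exact: Xinv|rewrite -e].
  have [YE|Y0] := Ctr Y Ycl YC Yinv; last first.
    suff : interior Y ((u + v) / 2) by rewrite Y0.
    apply: (@filterS _ _ _ `]u, v[%classic).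
      move=> c; rewrite /= in_itv /= => /andP[uc cv]; exists 0%N => //.
      by exists c => //; apply: uvX; rewrite /= in_itv /= !ltW.
    by apply: near_in_itvoo; rewrite in_itv /=; apply/andP; split; lra.
  move=> t tI; have : C t by rewrite CE; exists 0%N.
  rewrite -YE => -[i im [x Xx ex]].
  have ti : `[l i, r i]%classic t.
    by rewrite /= in_itv /= -ex; apply: orb => //; exact: Xi.
  have i0 : i = 0%N by apply: (tr i 0%N im m0); exists t.
  by rewrite -ex i0.
have [N [N0 [c hc]]] := transitive_horseshoe lr0 (@continuous_iter _ F m F_cont) Gin Gpm Gtr.
exists (N * m)%N; first by rewrite muln_gt0 N0.
move=> n; have [s [us <- hs]] := hc n.
have p := L_pieces hab F_cont F_in F_pm (n * (N * m)) (lexx a) (ltW hab) (lexx b).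
apply: (size_fiber_le hab p us (c := c)).
move=> t /hs[/andP[lt rt] <-]; split; first by apply/andP; split; lra.
have iterM i j x : iter i (iter j F) x = iter (i * j) F x.
  by elim: i => //= i ->; rewrite mulSn iterD.
by rewrite iterM mulnA [(n * N)%N]mulnC.
Qed.

Lemma entropy_bounds (f : R -> R) M :
  (forall n, lap_number a b (iter n f) = L n a b) ->
  (0 < M)%N -> (forall n, (2 ^ n <= L (n * M) a b)%N) ->
  [/\ 0 < entropy a b f,
    forall n, expR (entropy a b f) ^+ n <= (L n a b)%:R &
    forall e, 0 < e -> exists2 n, (0 < n)%N &
      (L n a b)%:R < (expR (entropy a b f) * (1 + e)) ^+ n].
Proof.
move=> LN M0 growth; have ab := ltW hab.
have Lpos n : 0 < (L n a b)%:R :> R by rewrite ltr0n; exact: (L_gt0 hab F_cont F_in F_pm n (lexx a) hab (lexx b)).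
have Lpow n j : (L (n * j) a b <= L n a b ^ j)%N.
  elim: j => [|j IH]; first by rewrite muln0 expn0; exact: L0_le1.
  rewrite mulnS expnSr; apply: leq_trans (L_submult hab F_cont F_in F_pm _ _ (lexx a) ab (lexx b)) _.
  by rewrite leq_mul2r IH orbT.
pose E := [set n%:R^-1 * ln (lap_number a b (iter n f))%:R
      | n in [set n : nat | (1 <= n)%N]] : set R.
(* A lower bound for all terms of the infimum, because [2 ^ n <= L (n * M) a b <= L n a b ^ M]. *)
pose d : R := ln 2 / M%:R.
have d0 : 0 < d by rewrite divr_gt0 ?ltr0n // ln_gt0 // ltr1n.
have Elb : lbound E d.
  move=> _ [n n1 <-]; rewrite LN.
  rewrite ler_pdivrMr ?ltr0n // -mulrA ler_pdivlMl ?ltr0n // [leRHS]mulrC.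
  rewrite -ler_expR !expRM_natl !lnK ?posrE //.
  rewrite -!natrX ler_nat; exact: leq_trans (growth n) (Lpow n M).
have E0 : nonempty E by exists (1%:R^-1 * ln (lap_number a b (iter 1 f))%:R); exists 1%N.
have Einf : has_inf E.
  split; [exact: E0|exists d; exact: Elb].
have hE : entropy a b f = inf E by [].
split.
- by rewrite hE; apply: lt_le_trans d0 _; exact: lb_le_inf.
- case=> [|n]; first by rewrite expr0 ler1n -(ltr0n R).
  rewrite -expRM_natl -[leRHS]lnK ?posrE // ler_expR.
  rewrite -ler_pdivlMl ?ltr0n // hE -LN.
  by apply: ge_inf; [exact: Einf.2|exists n.+1].
(* Some term of the infimum lies within [ln (1 + e)] of the entropy; exponentiating gives the
   rate. *)
- move=> e e0; have le0 : 0 < ln (1 + e) by rewrite ln_gt0 //; lra.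
  have [_ [n n1 <-]] := inf_adherent le0 Einf.
  rewrite LN => h; exists n => //.
  have e1 : 0 < 1 + e by lra.
  have -> : expR (entropy a b f) * (1 + e) = expR (entropy a b f + ln (1 + e)).
    by rewrite expRD lnK // posrE.
  rewrite -expRM_natl -[ltLHS]lnK ?posrE // ltr_expR.
  by rewrite -ltr_pdivrMl ?ltr0n // hE.
Qed.

End Entropy.


Theorem theorem1 (R : realType) (a b : R) (hab : a < b) (f : R -> R)
    (hpm : piecewise_monotone a b f) (het : essentially_transitive a b f) :
  0 < entropy a b f /\
  exists g : R -> R,
    uniformly_piecewise_linear a b (expR (entropy a b f)) g /\
    conjugate a b f g.
Proof.
have [[f_cont f_ab] [p0 [d0 mp0]]] := hpm.
have [_ [C [[[m [m0 C_closed C_sub [B [Bitv Btriv CB Bstep Blast]]]] Ctr] Cabs]]] := het.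
pose F := f \o clamp a b.
have F_cont : continuous F by exact: continuous_comp_clamp.
have FE x : a <= x <= b -> F x = f x by move=> xi; rewrite /F /= clamp_id.
have F_in x : a <= F x <= b.
  have : `[a, b]%classic (F x).
    by apply: f_ab; exists (clamp a b x) => //; rewrite /= in_itv /= clamp_in.
  by rewrite /= in_itv.
have pf := monotone_partition_pieces mp0.
have F_pm : exists n, pieces F n a b.
  by exists p0.+1; apply: pieces_ext pf => u ui; rewrite FE.
have iterE n x : a <= x <= b -> iter n f x = iter n F x.
  by move=> xi; elim: n => //= n ->; rewrite FE //; exact: iter_in.
have LN n : lap_number a b (iter n f) = lapc (iter n F) a b.
  have [k pk] := pieces_iter hab F_cont F_in F_pm n.
  have pk' : pieces (iter n f) k a b by apply: pieces_ext pk => u /iterE ->.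
  by rewrite (lap_number_lapc hab pk'); apply: lapc_ext => u /iterE.
have Cab x : C x -> a <= x <= b by move=> /C_sub; rewrite /= in_itv.
(* Endpoints are chosen for all [k], with a dummy value when [m <= k]. *)
have [lr lrP] : exists lr : nat -> R * R, forall k, (k < m)%N ->
    (lr k).1 < (lr k).2 /\ B k = `[(lr k).1, (lr k).2]%classic.
  have h k : exists lr : R * R, (k < m)%N ->
      lr.1 < lr.2 /\ B k = `[lr.1, lr.2]%classic.
    have [/Bitv[l [r [lr Bk]]]|_] := ltnP k m; first by exists (l, r).
    by exists (a, b).
  by have [lr hlr] := choice h; exists lr.
pose l k := (lr k).1; pose r k := (lr k).2.
have BE k : (k < m)%N -> B k = `[l k, r k]%classic by move=> /lrP[].
have CE : C = \bigcup_(k < m) `[l k, r k]%classic.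
  by rewrite CB; apply: eq_bigcupr => k /BE.
have BC k x : (k < m)%N -> B k x -> a <= x <= b.
  by move=> km Bx; apply: Cab; rewrite CB; exists k.
have Bnext k x : (k.+1 < m)%N -> B k x -> B k.+1 (F x).
  move=> km Bx; rewrite FE ?(BC k) ?(ltnW km) //.
  apply: (Bstep k.+1); last by exists x.
  by rewrite ltn_predRL.
have Bfirst x : B m.-1 x -> B 0%N (F x).
  move=> Bx; rewrite FE; last by apply: BC Bx; rewrite prednK.
  by apply: Blast; exists x.
have C_inv x : C x -> C (F x).
  rewrite CB => -[k /= km Bx]; have [km'|mk] := ltnP k.+1 m.
    by exists k.+1 => //; exact: Bnext.
  exists 0%N => //; apply: Bfirst; suff <- : k = m.-1 by [].
  by lia.
have Ctr' (X : set R) : closed X -> X `<=` C -> (forall x, X x -> X (F x)) ->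
    X = C \/ interior X = set0.
  move=> Xcl XC Xinv; apply: Ctr => // _ [x Xx <-].
  by rewrite -FE; [exact: Xinv|exact/Cab/XC].
have [M M0 growth] : exists2 M, (0 < M)%N &
    forall n, (2 ^ n <= lapc (iter (n * M) F) a b)%N.
  apply: (@cycle_lap_growth _ a b F hab F_cont F_in F_pm C m l r) => //.
  - by move=> k /lrP[].
  - move=> i j im jm; rewrite -(BE i im) -(BE j jm); exact: Btriv.
  - move=> k x km xi; have : B k.+1 (F x).
      by apply: Bnext => //; rewrite BE ?(ltnW km) //= in_itv.
    by rewrite BE //= in_itv.
  - move=> x xi; have : B 0%N (F x).
      by apply: Bfirst; rewrite BE ?prednK //= in_itv.
    by rewrite BE //= in_itv.
have [h0 L_low L_rate] := entropy_bounds hab F_cont F_in F_pm LN M0 growth.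
split; first exact: h0.
pose beta := expR (entropy a b f).
have beta1 : 1 < beta by rewrite expR_gt1.
have beta0 : 0 < beta by exact: expR_gt0.
have [psi [psi_a psi_b psi_mono psi_contr [psi_incr psi_decr]]] :=
  semiconjugacy hab F_cont F_in F_pm beta1 L_low L_rate.
have psi_cont : {within `[a, b], continuous psi}.
  exact: (semiconjugacy_continuous hab F_cont F_in F_pm beta1 psi_mono psi_contr).
have Cabs' : countable (`[a, b] `\` [set x | exists n, C (iter n F x)]).
  apply: sub_countable Cabs; apply: subset_card_le => x [xi nx]; split => //.
  move=> [_ [n Cn]]; apply: nx; exists n; rewrite -iterE //.
have psi_lt := semiconjugacy_inj hab F_cont F_in F_pm beta0 psi_a psi_b psi_mono
  psi_cont psi_incr psi_decr C_closed C_sub C_inv Ctr' CE Cabs'.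
(* [psi] has values in [[0, 1]]; it is rescaled to a map onto [[a, b]]. *)
pose Psi x := a + (b - a) * psi (clamp a b x).
have ba : 0 < b - a by lra.
have PsiE x : a <= x <= b -> Psi x = a + (b - a) * psi x.
  by move=> xi; rewrite /Psi clamp_id.
have Psi_cont : continuous Psi.
  have pc := continuous_comp_clamp hab psi_cont.
  move=> x; apply: cvgD; first exact: cvg_cst.
  by apply: cvgM; [exact: cvg_cst|exact: pc].
have aI : a <= a <= b by rewrite lexx ltW.
have bI : a <= b <= b by rewrite lexx ltW.
have Psi_a : Psi a = a by rewrite PsiE // psi_a; lra.
have Psi_b : Psi b = b by rewrite PsiE // psi_b; lra.
have Psi_lt x y : a <= x <= b -> a <= y <= b -> (Psi x < Psi y) = (x < y).
  move=> xi yi; rewrite !PsiE // ltrD2l ltr_pM2l //.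
  case/andP: (xi) => ax xb; case/andP: (yi) => ay yb.
  have [xy|yx] := ltP x y; first by rewrite psi_lt.
  by rewrite ltNge psi_mono.
have Psi_le x y : a <= x <= b -> a <= y <= b -> (Psi x <= Psi y) = (x <= y).
  by move=> xi yi; rewrite !leNgt Psi_lt.
have Psi_in x : a <= x <= b -> a <= Psi x <= b.
  move=> xi; have := Psi_le a x aI xi; have := Psi_le x b xi bI.
  by rewrite Psi_a Psi_b; case/andP: xi => -> -> -> ->.
have [phi0 phi0P] : exists phi0 : R -> R, forall y, a <= y <= b ->
    a <= phi0 y <= b /\ Psi (phi0 y) = y.
  have h y : exists x, a <= y <= b -> a <= x <= b /\ Psi x = y.
    have [yi|] := boolP (a <= y <= b); last by exists a.
    have [|x xi e] := @cont_surj _ Psi Psi_cont a b y (ltW hab).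
      by left; rewrite Psi_a Psi_b.
    by exists x.
  by have [phi0 hp] := choice h; exists phi0.
have inj x y : a <= x <= b -> a <= y <= b -> Psi x = Psi y -> x = y.
  by move=> xi yi e; apply/eqP; rewrite eq_le -(Psi_le x y) // -(Psi_le y x) // e lexx.
pose phi := phi0 \o clamp a b.
have phi_in y : a <= phi y <= b by have [] := phi0P _ (clamp_in hab y).
have phiK y : a <= y <= b -> Psi (phi y) = y.
  by move=> yi; rewrite /phi /= clamp_id //; have [] := phi0P _ yi.
have PsiK x : a <= x <= b -> phi (Psi x) = x.
  by move=> xi; apply: inj => //; rewrite phiK //; exact: Psi_in.
have phi_cont : continuous phi.
  apply: continuous_comp_clamp => //.
  (* On [[a, b]], [phi0] inverts the continuous map [Psi], hence is continuous. *)
  suff : {within `[Psi a, Psi b], continuous phi0} by rewrite Psi_a Psi_b.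
  apply: segment_can_le_continuous; [exact: ltW|exact: continuous_subspaceT|].
  move=> x; rewrite in_itv /= => xi; have [h1 h2] := phi0P _ (Psi_in _ xi).
  exact: inj.
pose g := Psi \o (F \o phi).
have g_cont : continuous g.
  move=> x; apply: continuous_comp; last exact: Psi_cont.
  by apply: continuous_comp; [exact: phi_cont|exact: F_cont].
have gPsi x : a <= x <= b -> g (Psi x) = Psi (F x).
  by move=> xi; rewrite /g /= PsiK.
have [p [d [[mp tp] _]]] := lap_partition_exists hab pf.
have [da db lapk] := mp.
have d_in k : (k <= p.+1)%N -> a <= d k <= b.
  by move=> kp; apply/andP; exact: (monotone_partition_ge mp).
(* On a lap of [f] the increments of [psi] are multiplied by [beta], up to sign. In the coordinate
   [Psi] this makes [g] affine, and the value at the left endpoint determines the constant. *)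
have affine k : (k <= p)%N -> exists s c, (s = beta \/ s = - beta) /\
    forall y, Psi (d k) <= y <= Psi (d k.+1) -> g y = s * y + c.
  move=> kp; have [dlt /strictly_monotone_onP sf] := lapk k kp.
  have dk := d_in k (leqW kp); have dk1 := d_in k.+1 kp.
  have sF : smono F (d k) (d k.+1).
    apply: smono_ext sf => u /andP[? ?]; rewrite FE //.
    by case/andP: dk dk1 => ? ? /andP[? ?]; apply/andP; split; lra.
  have loc y : Psi (d k) <= y <= Psi (d k.+1) ->
      [/\ a <= y <= b, d k <= phi y & phi y <= d k.+1].
    move=> /andP[dy yd].
    have yi : a <= y <= b.
      case/andP: (Psi_in _ dk) (Psi_in _ dk1) => ? ? /andP[? ?].
      by apply/andP; split; lra.
    by split => //; rewrite -Psi_le // phiK.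
  case/andP: (dk) => adk _.
  have PF y : g y = a + (b - a) * psi (F (phi y)) by rewrite /g /= PsiE.
  case: sF => sF.
    exists beta, (Psi (F (d k)) - beta * Psi (d k)); split; first by left.
    move=> y /loc[yi dy yd]; rewrite PF -{2}(phiK y yi) !PsiE //.
    have fi : incr F (d k) (phi y) by move=> u v ? ? ?; apply: sF => //; lra.
    case/andP: (phi_in y) => _ phib.
    have := psi_incr _ _ adk dy phib fi.
    by move=> E; rewrite -[psi (F (phi y))](subrK (psi (F (d k)))) E; ring.
  exists (- beta), (Psi (F (d k)) + beta * Psi (d k)); split; first by right.
  move=> y /loc[yi dy yd]; rewrite PF -{2}(phiK y yi) !PsiE //.
  have fi : decr F (d k) (phi y) by move=> u v ? ? ?; apply: sF => //; lra.
  case/andP: (phi_in y) => _ phib.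
  have := psi_decr _ _ adk dy phib fi.
  move=> E; rewrite -[psi (F (phi y))](subKr (psi (F (d k)))) E; ring.
have g_map : interval_map a b g.
  split; first exact: continuous_subspaceT.
  by move=> _ [x _ <-]; rewrite /= in_itv /=; apply: Psi_in; exact: F_in.
have g_part : monotone_partition a b g p (Psi \o d).
  split; rewrite /= ?da ?db // => k kp; split.
    by rewrite Psi_lt ?d_in ?(leqW kp) //; case: (lapk k kp).
  apply/strictly_monotone_onP; have [s [c [sb gE]]] := affine k kp.
  have E u v : Psi (d k) <= u -> u < v -> v <= Psi (d k.+1) ->
      g v - g u = s * (v - u) /\ 0 < beta * (v - u).
    move=> du uv vd; split; last by apply: mulr_gt0 => //; lra.
    by rewrite !gE ?du ?vd /=; [ring|lra|lra].
  case: sb => sb; [left|right] => u v du uv vd;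
    by have [] := E u v du uv vd; rewrite sb; lra.
(* [Psi] preserves order, so monotonicity of [g] around [Psi (d k)] would carry back through [phi]
   to monotonicity of [f] around its turning point [d k]. *)
have g_lap : lap_partition a b g p (Psi \o d).
  split => // k kp u v au ud dv vb mo.
  have dk : a <= d k <= b by case/andP: (kp) => _ kp'; apply: d_in; exact: leqW.
  have /andP[aD Db] := Psi_in _ dk.
  have uI : a <= u <= b by rewrite au (le_trans (ltW ud)).
  have vI : a <= v <= b by rewrite vb andbT (le_trans aD) // ltW.
  have ud' : phi u < d k by rewrite -Psi_lt // phiK.
  have dv' : d k < phi v by rewrite -Psi_lt // phiK.
  case/andP: (phi_in u) (phi_in v) => pu1 pu2 /andP[pv1 pv2].
  apply: (tp k kp (phi u) (phi v)) => //.
  have I x : x \in `]phi u, phi v[ -> a <= x <= b /\ Psi x \in `]u, v[.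
    rewrite !in_itv /= => /andP[ux xv].
    have xi : a <= x <= b by apply/andP; split; lra.
    by split => //; rewrite -(phiK u) // -(phiK v) // !Psi_lt // ux.
  case: mo => mo; [left|right] => x y xI yI xy;
    have [xi xI'] := I x xI; have [yi yI'] := I y yI.
    rewrite -(FE x xi) -(FE y yi) -Psi_le // -(gPsi x xi) -(gPsi y yi).
    by apply: mo => //; rewrite Psi_le.
  rewrite -(FE x xi) -(FE y yi) -Psi_le // -(gPsi x xi) -(gPsi y yi).
  by apply: mo => //; rewrite Psi_le.
exists g; split.
  have g_pm : piecewise_monotone a b g by split => //; exists p, (Psi \o d).
  by split => //; exists p, (Psi \o d).
exists Psi; split.
  split.
    split; first exact: continuous_subspaceT.
    by move=> _ [x + <-]; rewrite /= !in_itv /=; exact: Psi_in.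
  exists phi; split.
  - split; first exact: continuous_subspaceT.
    by move=> _ [x _ <-]; rewrite /= in_itv /=; exact: phi_in.
  - by move=> x; rewrite in_itv /=; exact: PsiK.
  - by move=> x; rewrite in_itv /=; exact: phiK.
by move=> x; rewrite in_itv /= => xi; rewrite gPsi // FE.
Qed.
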